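(* Let $u,w:\mathscr S(\mathbf R^d)\to L_0^2(\Omega)$ be uncorrelated tempered generalized stochastic processes with covariance operators $\mathscr K_u,\mathscr K_w$. Suppose that $\mathscr K_u,\mathscr K_w\in\mathscr L(\mathscr H)$ where $\mathscr H$ is a Hilbert space of distributions defined on $\mathbf R^d$, that $\mathscr K_u\ge0$ and $\mathscr K_w\ge0$ on $\mathscr H$, and that $\mathscr K_u\mathscr K_w=\mathscr K_w\mathscr K_u$. Then there exists a Borel measure $\Pi$, compactly supported on $\mathbf C_+=\{x+iy\in\mathbf C: x\ge0,\ y\ge0\}$, with values in the projections in $\mathscr L(\mathscr H)$, and there exist non-negative functions $f_u,f_w\in C_c(\mathbf C_+)$, such that $$\mathscr K_u=\int_{\mathbf C_+}f_u(z)\,\mathrm d\Pi(z),\qquad \mathscr K_w=\int_{\mathbf C_+}f_w(z)\,\mathrm d\Pi(z),$$ and the solution to the operator equation $\mathscr K_u=F(\mathscr K_u+\mathscr K_w)$ is given by $$F=\int_{\mathbf C_+}f(z)\,\mathrm d\Pi(z)\in\mathscr L(\mathscr H),\qquad f(z)=\frac{f_u(z)}{f_u(z)+f_w(z)}\,\chi_{\operatorname{supp}f_u}(z),$$ where $f(z)$ is understood as $0$ whenever $f_u(z)=0$. The solution satisfies $F\ge0$ and is unique in the bounded functional calculus of $\Pi$.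
   Context: Let $(\Omega,\mathscr B,\mathbf P)$ be a probability space and $L_0^2(\Omega)$ the Hilbert space of complex zero mean random variables with finite variance. A tempered generalized stochastic process (GSP) is a continuous conjugate linear map $u:\mathscr S(\mathbf R^d)\to L_0^2(\Omega)$, $\varphi\mapsto(u,\varphi)$. GSPs $u,w$ are uncorrelated if $\mathbf E((u,\varphi)\overline{(w,\psi)})=0$ for all test functions $\varphi,\psi$. The covariance operator $\mathscr K_u:\mathscr S(\mathbf R^d)\to\mathscr S'(\mathbf R^d)$ of $u$ is the linear continuous operator defined by $(\mathscr K_u\psi,\varphi)=\mathbf E((u,\varphi)\overline{(u,\psi)})$, where distributions act conjugate linearly on test functions. $\mathscr L(\mathscr H)$ is the space of bounded linear operators on $\mathscr H$, and $\chi_A$ is the indicator function of $A$. The bounded functional calculus of the projection-valued measure $\Pi$ consists of the operators $\int_{\mathbf C_+}g(z)\,\mathrm d\Pi(z)$ with $g\in L^\infty(\mathbf C_+,\Pi)$ (bounded Borel functions modulo $\Pi$-a.e. equality). *)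

(* Defs.v *)
From HB Require Import structures.
From mathcomp Require Import all_boot all_order all_algebra.
From mathcomp Require Import complex.
From mathcomp Require Import all_classical all_reals all_analysis.

Set Implicit Arguments.
Unset Strict Implicit.
Unset Printing Implicit Defensive.

Import Order.TTheory GRing.Theory Num.Theory.
Import numFieldNormedType.Exports.

Local Open Scope classical_set_scope.
Local Open Scope ring_scope.

(* Naming R[i] as a numClosedFieldType gives it the topology and the norm of a
   numFieldType; on this type 0 <= z means that z is real and nonnegative. *)
Definition Cx (R : realType) : numClosedFieldType := R[i].

Section TestFunctions.
Context {R : realType} {d : nat}.
Implicit Types (f g : 'rV[R]_d -> R) (phi psi : 'rV[R]_d -> Cx R).

Definition pderiv (s : seq 'I_d) f : 'rV[R]_d -> R :=
  foldr (fun i g x => 'D_(delta_mx 0 i) g x) f s.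

Definition smooth f : Prop :=
  forall s : seq 'I_d,
    continuous (pderiv s f) /\
    forall i x, derivable (pderiv s f) x (delta_mx 0 i).

Definition rapidly_decreasing f : Prop :=
  forall (k : nat) (s : seq 'I_d),
    exists M : R, forall x, `|x| ^+ k * `|pderiv s f x| <= M.

Definition schwartz_real f : Prop := smooth f /\ rapidly_decreasing f.

Definition cpart_re phi : 'rV[R]_d -> R := fun x => complex.Re (phi x).
Definition cpart_im phi : 'rV[R]_d -> R := fun x => complex.Im (phi x).

Definition schwartz_pred : {pred 'rV[R]_d -> Cx R} :=
  mem [set phi | schwartz_real (cpart_re phi) /\ schwartz_real (cpart_im phi)].

Definition cpderiv (s : seq 'I_d) phi : 'rV[R]_d -> Cx R :=
  fun x => (pderiv s (cpart_re phi) x +i* pderiv s (cpart_im phi) x)%C.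

Lemma pderiv_lin (a b : R) f g s : smooth f -> smooth g ->
  pderiv s (fun x => a * f x + b * g x) =
  (fun x => a * pderiv s f x + b * pderiv s g x).
Proof.
move=> sf sg; elim: s => [//|i s IH] /=; rewrite IH.
apply/funext => x.
have df := (sf s).2 i x; have dg := (sg s).2 i x.
have := @deriveD _ _ _ (a \*: pderiv s f) (b \*: pderiv s g) x (delta_mx 0 i)
  (derivableZ (k := a) df) (derivableZ (k := b) dg).
by rewrite !deriveZ.
Qed.

Lemma schwartz_real_lin (a b : R) f g : schwartz_real f -> schwartz_real g ->
  schwartz_real (fun x => a * f x + b * g x).
Proof.
move=> [sf rf] [sg rg]; split.
- move=> s; rewrite pderiv_lin//; split.
    move=> x.
    exact: cvgD (cvgM (cvg_cst a) ((sf s).1 x)) (cvgM (cvg_cst b) ((sg s).1 x)).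
  move=> i x; apply: (@derivableD _ _ _ (a \*: pderiv s f) (b \*: pderiv s g)).
    exact: (derivableZ (k := a) ((sf s).2 i x)).
  exact: (derivableZ (k := b) ((sg s).2 i x)).
- move=> k s; rewrite pderiv_lin//.
  have [M HM] := rf k s; have [N HN] := rg k s.
  exists (`|a| * M + `|b| * N) => x.
  apply: (@le_trans _ _ (`|x| ^+ k * (`|a * pderiv s f x| + `|b * pderiv s g x|))).
    by apply: ler_wpM2l; [exact: exprn_ge0 | exact: ler_normD].
  rewrite mulrDr !normrM mulrCA [X in _ + X <= _]mulrCA.
  by apply: lerD; apply: ler_wpM2l.
Qed.

Lemma schwartz_real0 : schwartz_real (fun=> 0).
Proof.
have E s : pderiv s (fun=> 0) = fun=> 0.
  elim: s => [//|i s IH] /=; rewrite IH.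
  by apply/funext => x; rewrite (derive_cst (0 : R)).
split=> [s|k s]; rewrite E.
  split; last by move=> i x; exact: (derivable_cst (0 : R)).
  by move=> x; exact: (@cst_continuous _ _ (0 : R) x).
by exists 0 => x; rewrite normr0 mulr0.
Qed.

Lemma schwartz_submod_closed : submod_closed schwartz_pred.
Proof.
split.
  by apply/mem_set; split; exact: schwartz_real0.
move=> a phi psi /set_mem[p1 p2] /set_mem[q1 q2]; apply/mem_set; split.
- have := schwartz_real_lin 1 1
    (schwartz_real_lin (complex.Re a) (- complex.Im a) p1 p2) q1.
  congr (schwartz_real _); apply/funext => x; rewrite /cpart_re /cpart_im.
  rewrite [in RHS]/GRing.add [in RHS]/GRing.scale/= /GRing.scale/=.
  by case: a (phi x) (psi x) => [a1 a2] [b1 b2] [c1 c2] /=; rewrite !mul1r mulNr.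
- have := schwartz_real_lin 1 1
    (schwartz_real_lin (complex.Re a) (complex.Im a) p2 p1) q2.
  congr (schwartz_real _); apply/funext => x; rewrite /cpart_re /cpart_im.
  rewrite [in RHS]/GRing.add [in RHS]/GRing.scale/= /GRing.scale/=.
  case: a (phi x) (psi x) => [a1 a2] [b1 b2] [c1 c2] /=; rewrite !mul1r.
  by [].
Qed.

HB.instance Definition _ :=
  GRing.isSubmodClosed.Build (Cx R) ('rV[R]_d -> Cx R) schwartz_pred
    schwartz_submod_closed.


Definition schwartz : Type := {phi | phi \in schwartz_pred}.
HB.instance Definition _ := SubType.on schwartz.
HB.instance Definition _ := Choice.on schwartz.
HB.instance Definition _ := [SubChoice_isSubLmodule of schwartz by <:].

Definition weighted_derivatives (phi : schwartz) :
    {ptws (nat * seq 'I_d) -> {uniform 'rV[R]_d -> Cx R}} :=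
  fun ks x => (`|x| ^+ ks.1)%:C%C * cpderiv ks.2 (val phi) x.

(* The initial topology of weighted_derivatives is the Frechet topology of the
   seminorms sup_x |x|^k |D^s phi x|. *)
HB.instance Definition _ :=
  Topological.copy schwartz (initial_topology weighted_derivatives).

End TestFunctions.

Arguments schwartz R d : clear implicits.

Section Distributions.
Context {R : realType} {d : nat}.

Record tempered := Tempered {
  tempered_fun :> schwartz R d -> Cx R;
  tempered_conj_linear : linear_for (Num.conj \; *%R) tempered_fun;
  tempered_continuous : continuous tempered_fun
}.

(* On continuous rapidly decreasing functions, the only ones it is applied to
   here, the iterated integral is the Lebesgue integral over R^d (Fubini). *)
Fixpoint integral_Rd (n : nat) : ('rV[R]_n -> R) -> R :=
  match n with
  | 0 => fun f => f 0
  | n'.+1 => fun f =>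
      \int[lebesgue_measure]_(t in [set: R])
        integral_Rd (fun y : 'rV[R]_n' => f (row_mx (t%:M : 'rV[R]_1) y))
  end.

Definition cintegral_Rd (f : 'rV[R]_d -> Cx R) : Cx R :=
  (integral_Rd (cpart_re f) +i* integral_Rd (cpart_im f))%C.

Definition dist_of_test (psi phi : schwartz R d) : Cx R :=
  cintegral_Rd (fun x => val psi x * (val phi x)^*).

End Distributions.

Arguments tempered R d : clear implicits.

Section StochasticProcesses.
Context {R : realType} {d : nat} {disp : measure_display}
  {Omega : measurableType disp} (P : probability Omega R).
Implicit Types X Y : Omega -> Cx R.

Definition cE X : Cx R :=
  (fine 'E_P[fun w => complex.Re (X w)] +i*
   fine 'E_P[fun w => complex.Im (X w)])%C.

Definition zero_mean_L2 X : Prop :=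
  [/\ (fun w => complex.Re (X w)) \in Lfun P 2%:E,
      (fun w => complex.Im (X w)) \in Lfun P 2%:E & cE X = 0].

(* Elements of L^2_0 are given by representatives: linearity holds almost
   surely, and convergence is convergence in mean square. *)
Definition gsp (u : schwartz R d -> Omega -> Cx R) : Prop :=
  [/\ forall phi, zero_mean_L2 (u phi),
      forall (a : Cx R) phi psi,
        {ae P, forall w, u (a *: phi + psi) w = a^* * u phi w + u psi w} &
      forall phi, cE (fun w => `|u psi w - u phi w| ^+ 2) @[psi --> phi]
                    --> (0 : Cx R)].

Definition uncorrelated (u v : schwartz R d -> Omega -> Cx R) : Prop :=
  forall phi psi, cE (fun w => u phi w * (v psi w)^*) = 0.

(* Linearity and continuity of K follow from this formula. *)
Definition covariance_operator (u : schwartz R d -> Omega -> Cx R)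
    (K : schwartz R d -> tempered R d) : Prop :=
  forall psi phi, K psi phi = cE (fun w => u phi w * (u psi w)^*).

End StochasticProcesses.

Record hilbertSpace (R : realType) := HilbertSpace {
  hilbert_sort :> completeNormedModType (Cx R);
  hdot : {dot hilbert_sort for Num.conj};
  hdotE : forall x, hdot x x = `|x| ^+ 2
}.

Section Operators.
Context {R : realType} {H : hilbertSpace R}.
Implicit Types S T : H -> H.

Definition bounded_operator T : Prop :=
  linear T /\ exists M : Cx R, forall x, `|T x| <= M * `|x|.

Definition nonneg_operator T : Prop := forall x, 0 <= hdot H (T x) x.

Definition orthogonal_projection T : Prop :=
  [/\ bounded_operator T, forall x, T (T x) = T x &
      forall x y, hdot H (T x) y = hdot H x (T y)].

End Operators.

(* The embedding is continuous for the weak-* topology of S'(R^d). *)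
Record hilbert_of_distributions (R : realType) (d : nat) :=
  HilbertOfDistributions {
  hod_space :> hilbertSpace R;
  hod_dist : hod_space -> tempered R d;
  hod_dist_linear : forall (a : Cx R) x y phi,
    hod_dist (a *: x + y) phi = a * hod_dist x phi + hod_dist y phi;
  hod_dist_inj : forall x y,
    (forall phi, hod_dist x phi = hod_dist y phi) -> x = y;
  hod_dist_continuous : forall phi, continuous (fun x => hod_dist x phi)
}.

(* "K belongs to L(H), as the operator T": the test functions lying in H are
   dense in H and T is the bounded extension to H of the restriction of K to
   these test functions. *)
Definition bounded_on (R : realType) (d : nat)
    (H : hilbert_of_distributions R d)
    (K : schwartz R d -> tempered R d) (T : H -> H) : Prop :=
  let represents (x : H) psi :=
    forall phi, hod_dist x phi = dist_of_test psi phi in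
  [/\ bounded_operator T,
      closure [set x | exists psi, represents x psi] = [set: H] &
      forall x psi, represents x psi ->
        forall phi, hod_dist (T x) phi = K psi phi].

Section SpectralIntegrals.
Context {R : realType} {H : hilbertSpace R}.
Implicit Types (g : Cx R -> Cx R) (Pi : set (Cx R) -> H -> H) (T : H -> H).

Definition Cplus : set (Cx R) :=
  [set z | 0 <= complex.Re z /\ 0 <= complex.Im z].

Definition borel_Cplus : set (set (Cx R)) :=
  <<s Cplus, [set Cplus `&` U | U in open] >>.

(* Pi Cplus is a projection that need not be the identity: if it had to be,
   uniqueness of the filter would fail on Pi [set 0] as soon as the two
   covariance operators have a common kernel. *)
Definition projection_valued_measure Pi : Prop :=
  [/\ forall A, borel_Cplus A -> orthogonal_projection (Pi A),
      forall x, Pi set0 x = 0,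
      forall A B, borel_Cplus A -> borel_Cplus B ->
        forall x, Pi (A `&` B) x = Pi A (Pi B x) &
      forall A : nat -> set (Cx R),
        (forall n, borel_Cplus (A n)) -> trivIset setT A ->
        forall x, series (fun n => Pi (A n) x) @ \oo --> Pi (\bigcup_n A n) x].

Definition compactly_supported Pi : Prop :=
  exists K : set (Cx R), [/\ compact K, K `<=` Cplus &
    forall x, Pi (Cplus `\` K) x = 0].

Definition bounded_borel g : Prop :=
  (forall U : set (Cx R), open U -> borel_Cplus (Cplus `&` g @^-1` U)) /\
  exists M : Cx R, forall z, Cplus z -> `|g z| <= M.

Definition supp g : set (Cx R) :=
  Cplus `&` closure [set z | Cplus z /\ g z != 0].

Definition Cc_Cplus g : Prop :=
  {within Cplus, continuous g} /\ compact (supp g).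

(* The simple function and the operator sum_k c_k Pi(A_k), for s the sequence
   of the pairs (c_k, A_k). *)
Definition simple_fun (s : seq (Cx R * set (Cx R))) : Cx R -> Cx R :=
  fun z => \sum_(cA <- s) cA.1 * \1_(cA.2) z.

Definition simple_integral Pi (s : seq (Cx R * set (Cx R))) : H -> H :=
  fun x => \sum_(cA <- s) cA.1 *: Pi cA.2 x.

(* T is the integral of g with respect to Pi: the limit in operator norm of
   the integrals of simple Borel functions converging uniformly to g. *)
Definition spectral_integral Pi g T : Prop :=
  [/\ bounded_borel g, bounded_operator T &
      forall eps : Cx R, 0 < eps ->
        exists s, [/\ forall c A, (c, A) \in s -> borel_Cplus A,
          forall z, Cplus z -> `|g z - simple_fun s z| <= eps &
          forall x, `|T x - simple_integral Pi s x| <= eps * `|x|]].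

Definition bounded_functional_calculus Pi : set (H -> H) :=
  [set T | exists g, spectral_integral Pi g T].

Definition filter_symbol fu fw : Cx R -> Cx R :=
  fun z => if fu z == 0 then 0
           else fu z / (fu z + fw z) * \1_(supp fu) z.

End SpectralIntegrals.

(* Main.v *)
Require Import Defs.
From HB Require Import structures.
From mathcomp Require Import all_boot all_order all_algebra.
From mathcomp Require Import complex.
From mathcomp Require Import all_classical all_reals all_analysis.
From mathcomp Require Import ring lra.
Import Order.TTheory GRing.Theory Num.Theory.
Import numFieldNormedType.Exports.
Local Open Scope classical_set_scope.
Local Open Scope ring_scope.

Set Implicit Arguments.
Unset Strict Implicit.
Unset Printing Implicit Defensive.

(* The operators A = K_u / L and B = K_w / L, for L large, are commuting positive
   contractions.  A contraction 0 <= A <= 1 has a spectral projection P for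
   [1/2, 1], obtained from the square root |2A - 1| of (2A - 1)^2, and
   0 <= 2A - P <= 1; iterating gives commuting projections with
   A = sum_n 2^-(n+1) P_n.  The digits of A and B together are a sequence of
   commuting projections, that is, a representation of the Boolean algebra of
   clopen subsets of the Cantor space.  For each finite family of vectors the
   squared norms of the projected vectors form a finitely additive mass,
   countably additive by compactness, and the sets that clopen sets approximate
   in outer mass, for every such family, form a sigma-algebra on which the
   projections extend to a countably additive projection-valued measure.  Its
   image under the map sending digits to the point of [0, L]^2 they represent,
   with the point 0 removed, is the measure Pi; on the square f_u and f_w are
   the coordinates, so they integrate to K_u and K_w.  The symbol f satisfies
   f (f_u + f_w) = f_u, whence F (K_u + K_w) = K_u.  Two solutions G and F agree
   on the range of K_u + K_w, and both vanish on the common kernel of K_u and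
   K_w, where Pi is zero. *)

(** * The real inner product of a complex Hilbert space *)

(** All estimates use the real part [ip] of the inner product and squared norms, so that they become
    linear arithmetic over [R]. Most numerical constants come from the factor 2 in |x + y|^2 <=
    2|x|^2 + 2|y|^2.

    Binary expansions are not injective, so a digit is not a function of the point of the square
    that it helps to represent. The integrals of the coordinates are therefore computed on the
    Cantor space, where digits are clopen sets, and are matched with integrals over the quadrant by
    pulling simple functions back.

    Masses are taken over finite families of vectors because the algebraic laws of the measure
    compare its values at several vectors, and one clopen set has to approximate well at all of
    them.

    The symbol of the filter may be discontinuous where f_u and f_w both vanish. It is only a
    bounded Borel function, and its integral is a limit of simple ones whose coefficients are values
    of the symbol; this is how positivity reaches F. *)

Section RealInnerProduct.
Context {R : realType} {H : hilbertSpace R}.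
Implicit Types (x y z t : H) (a b : R).

Definition rscale a x : H := a%:C%C *: x.

Definition ip x y : R := complex.Re (hdot H x y).

Definition nsq x : R := ip x x.

Lemma ReJ (c : Cx R) : complex.Re c^* = complex.Re c.
Proof. by case: c => u v; exact: erefl. Qed.

Lemma ReD (c d : Cx R) : complex.Re (c + d) = complex.Re c + complex.Re d.
Proof. by case: c d => u v [u' v']; exact: erefl. Qed.

Lemma ReN (c : Cx R) : complex.Re (- c) = - complex.Re c.
Proof. by case: c => u v; exact: erefl. Qed.

Lemma ReM (c d : Cx R) : complex.Re (c * d) =
  complex.Re c * complex.Re d - complex.Im c * complex.Im d.
Proof. by case: c d => u v [u' v']; exact: erefl. Qed.

Lemma hdotC x y : hdot H x y = (hdot H y x)^*.
Proof. by rewrite hermC /= expr0 mul1r. Qed.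

Lemma ipC x y : ip x y = ip y x.
Proof. by rewrite /ip hdotC ReJ. Qed.

Lemma ipDl x y z : ip (x + y) z = ip x z + ip y z.
Proof. by rewrite /ip linearDl ReD. Qed.

Lemma ipNl x z : ip (- x) z = - ip x z.
Proof. by rewrite /ip linearNl ReN. Qed.

Lemma ipBl x y z : ip (x - y) z = ip x z - ip y z.
Proof. by rewrite ipDl ipNl. Qed.

Lemma ipZl a x z : ip (rscale a x) z = a * ip x z.
Proof. by rewrite /ip /rscale linearZl_LR ReM /= mul0r subr0. Qed.

Lemma ip0l z : ip 0 z = 0.
Proof. by rewrite -(subrr (0 : H)) ipBl subrr. Qed.

Lemma ipDr x y z : ip z (x + y) = ip z x + ip z y.
Proof. by rewrite ipC ipDl !(ipC z). Qed.

Lemma ipNr x z : ip z (- x) = - ip z x.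
Proof. by rewrite ipC ipNl (ipC z). Qed.

Lemma ipBr x y z : ip z (x - y) = ip z x - ip z y.
Proof. by rewrite ipDr ipNr. Qed.

Lemma ipZr a x z : ip z (rscale a x) = a * ip z x.
Proof. by rewrite ipC ipZl (ipC z). Qed.

Lemma ip0r z : ip z 0 = 0.
Proof. by rewrite ipC ip0l. Qed.

Definition ipE := (ipDl, ipBl, ipNl, ipZl, ip0l, ipDr, ipBr, ipNr, ipZr, ip0r).

Lemma normE x : `|x| = (Num.sqrt (nsq x))%:C%C.
Proof.
have xr : `|x| \is Num.real by [].
have /complex_realP[r nx] := xr.
have r0 : 0 <= r by rewrite -lecR -nx; exact: normr_ge0.
have : nsq x = r ^+ 2.
  by rewrite /nsq /ip hdotE nx expr2 /= mul0r subr0 expr2.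
by move=> ->; rewrite sqrtr_sqr ger0_norm.
Qed.

Lemma nsq_norm x : (nsq x)%:C%C = `|x| ^+ 2.
Proof.
have n0 : 0 <= `|x| ^+ 2 by rewrite exprn_ge0.
rewrite /nsq /ip hdotE; apply: RRe_real; exact: ger0_real.
Qed.

Lemma nsq_ge0 x : 0 <= nsq x.
Proof. by rewrite -ler0c nsq_norm exprn_ge0. Qed.

Lemma nsq_eq0 x : nsq x = 0 -> x = 0.
Proof. by move=> x0; apply/eqP; rewrite -normr_eq0 normE x0 sqrtr0. Qed.

Lemma norm_le_nsq a x y : 0 <= a ->
  (`|x| <= a%:C%C * `|y|) <-> (nsq x <= a ^+ 2 * nsq y).
Proof.
move=> a0; rewrite !normE -rmorphM lecR.
have -> : a * Num.sqrt (nsq y) = Num.sqrt (a ^+ 2 * nsq y).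
  by rewrite sqrtrM ?sqr_ge0// sqrtr_sqr ger0_norm.
by rewrite ler_sqrt ?mulr_ge0 ?sqr_ge0 ?nsq_ge0.
Qed.

Lemma ip_ext x y : (forall t, ip x t = ip y t) -> x = y.
Proof.
move=> xy; apply/eqP; rewrite -subr_eq0; apply/eqP/nsq_eq0.
by rewrite /nsq ipBl xy subrr.
Qed.

Lemma ip_CauchySchwarz x y : ip x y ^+ 2 <= nsq x * nsq y.
Proof.
(* The square expands to |x|^2 (|x|^2 |y|^2 - <x, y>^2). *)
have := nsq_ge0 (rscale (nsq x) y - rscale (ip x y) x).
rewrite /nsq !ipE (ipC y x) => h.
have [x0|x0] := eqVneq (nsq x) 0.
  by rewrite (nsq_eq0 x0) !ipE expr0n mul0r.
have xp : 0 < ip x x by rewrite lt_neqAle eq_sym x0 nsq_ge0.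
rewrite -subr_ge0 -(pmulr_rge0 _ xp); move: h.
by set u := ip x x; set v := ip y y; set w := ip x y; lra.
Qed.

Lemma nsqD2 x y : nsq (x + y) <= 2 * nsq x + 2 * nsq y.
Proof.
by have := nsq_ge0 (x - y); rewrite /nsq !ipE (ipC y x); lra.
Qed.

Lemma nsqB2 x y z : nsq (x - z) <= 2 * nsq (x - y) + 2 * nsq (y - z).
Proof.
have -> : x - z = (x - y) + (y - z) by rewrite addrA subrK.
exact: nsqD2.
Qed.

Lemma nsqN x : nsq (- x) = nsq x.
Proof. by rewrite /nsq !ipE opprK. Qed.

Lemma nsqBC x y : nsq (x - y) = nsq (y - x).
Proof. by rewrite -nsqN opprB. Qed.

Lemma nsqZ a x : nsq (rscale a x) = a ^+ 2 * nsq x.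
Proof. by rewrite /nsq !ipE mulrA expr2. Qed.

(** The triangle inequality with its sharp constant; the factor 2 of [nsqD2] would be too coarse for
    the square root iteration, whose majorants have to stay below 1. *)
Lemma nsq_triangle a b q x y : 0 <= a -> 0 <= b -> 0 <= q ->
  nsq x <= a ^+ 2 * q -> nsq y <= b ^+ 2 * q -> nsq (x + y) <= (a + b) ^+ 2 * q.
Proof.
move=> a0 b0 q0 xa yb.
have abq : 0 <= a * b * q by rewrite !mulr_ge0.
have : ip x y <= a * b * q.
  have [//|lt] := leP (ip x y) (a * b * q).
  have := ip_CauchySchwarz x y; have := nsq_ge0 x; have := nsq_ge0 y.
  have h1 : nsq x * nsq y <= (a * b * q) ^+ 2.
    have -> : (a * b * q) ^+ 2 = (a ^+ 2 * q) * (b ^+ 2 * q) by ring.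
    by rewrite ler_pM ?nsq_ge0.
  move=> _ _ h2; have := le_trans h2 h1.
  by rewrite ler_sqr ?nnegrE ?(ltW (le_lt_trans abq lt))//; lra.
rewrite /nsq !ipE (ipC y x) -/(nsq x) -/(nsq y).
have -> : (a + b) ^+ 2 * q = a ^+ 2 * q + b ^+ 2 * q + 2 * (a * b * q) by ring.
lra.
Qed.

Lemma nsqZc (c : Cx R) x : nsq (c *: x) = (complex.Re c ^+ 2 + complex.Im c ^+ 2) * nsq x.
Proof.
apply: complexI; rewrite rmorphM /= nsq_norm normrZ exprMn -nsq_norm.
by rewrite add_Re2_Im2.
Qed.

Lemma scalec_real a x : a%:C%C *: x = rscale a x. Proof. by []. Qed.

Definition lims (f : nat -> H) x : Prop :=
  forall e : R, 0 < e -> exists N, forall n, (N <= n)%N -> nsq (f n - x) <= e.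

Lemma limsP f x : lims f x <-> f @ \oo --> x.
Proof.
split=> [h|/cvgrPdist_le h].
  apply/cvgrPdist_le => e e0.
  have /complex_realP[r er] : e \is Num.real by rewrite gtr0_real.
  have r0 : 0 < r by rewrite -ltcR -er.
  have [N hN] := h (r ^+ 2) (exprn_gt0 2 r0).
  exists N => // n /= Nn; rewrite er normE lecR nsqBC.
  by rewrite -(ger0_norm (ltW r0)) -sqrtr_sqr ler_sqrt ?sqr_ge0// hN.
move=> e e0.
have se0 : 0 < Num.sqrt e by rewrite sqrtr_gt0.
have [|N _ hN] := h (Num.sqrt e)%:C%C; first by rewrite ltcR.
exists N => n Nn; have := hN n Nn; rewrite normE lecR nsqBC.
by rewrite ler_sqrt // ltW.
Qed.

Definition cauchys (f : nat -> H) : Prop :=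
  forall e : R, 0 < e -> exists N, forall m n, (N <= m)%N -> (N <= n)%N ->
    nsq (f m - f n) <= e.

Lemma cauchys_lims f : cauchys f -> exists x, lims f x.
Proof.
move=> cf.
have : cauchy (f @ \oo).
  apply/cauchyP => e e0.
  have /complex_realP[r er] : e \is Num.real by rewrite gtr0_real.
  have r0 : 0 < r by rewrite -ltcR -er.
  have [N hN] := cf ((r / 2) ^+ 2) (exprn_gt0 2 (divr_gt0 r0 (ltr0n _ 2))).
  exists (f N); exists N => // n /= Nn.
  rewrite -ball_normE /= er normE ltcR.
  rewrite (@le_lt_trans _ _ (r / 2)) //; last by lra.
  rewrite -[leRHS]ger0_norm; last by lra.
  by rewrite -sqrtr_sqr ler_sqrt ?sqr_ge0// hN.
move/cauchy_cvgP/cvg_ex => [x fx]; exists x; exact/limsP.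
Qed.

Lemma lims_unique f x y : lims f x -> lims f y -> x = y.
Proof.
move=> fx fy; apply/eqP; rewrite -subr_eq0; apply/eqP/nsq_eq0/eqP.
rewrite eq_le nsq_ge0 andbT; apply/ler_addgt0Pr => e e0; rewrite add0r.
have [|N1 h1] := fx (e / 4); first by lra.
have [|N2 h2] := fy (e / 4); first by lra.
have := nsqB2 x (f (maxn N1 N2)) y.
have := h1 _ (leq_maxl N1 N2); have := h2 _ (leq_maxr N1 N2).
rewrite (nsqBC x (f _)); lra.
Qed.

Lemma lims_cst x : lims (fun=> x) x.
Proof. by move=> e e0; exists 0%N => n _; rewrite subrr /nsq ip0l ltW. Qed.

Lemma limsD f g x y : lims f x -> lims g y -> lims (fun n => f n + g n) (x + y).
Proof. by rewrite !limsP; exact: cvgD. Qed.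

Lemma limsB f g x y : lims f x -> lims g y -> lims (fun n => f n - g n) (x - y).
Proof. by rewrite !limsP; exact: cvgB. Qed.

Lemma limsZ (c : Cx R) f x : lims f x -> lims (fun n => c *: f n) (c *: x).
Proof. by rewrite !limsP; exact: cvgZr. Qed.

Lemma eq_lims f g x : f =1 g -> lims f x -> lims g x.
Proof. by move=> /funext ->. Qed.

Lemma lims_shift k f x : lims f x -> lims (fun n => f (n + k)%N) x.
Proof.
move=> fx e e0; have [N h] := fx e e0; exists N => n Nn.
by apply: h; rewrite (leq_trans Nn) ?leq_addr.
Qed.

Lemma lims_ip f x y : lims f x ->
  forall e : R, 0 < e -> exists N, forall n, (N <= n)%N ->
    `|ip (f n) y - ip x y| <= e.
Proof.
move=> fx e e0.
have y1 : 0 < nsq y + 1 by have := nsq_ge0 y; lra.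
have [|N h] := fx (e ^+ 2 / (nsq y + 1)); first by rewrite divr_gt0 ?exprn_gt0.
exists N => n Nn; rewrite -ipBl -(ler_sqr (_ : _ \is Num.nneg)) ?nnegrE//; last exact: ltW.
rewrite real_normK ?num_real//; apply: le_trans (ip_CauchySchwarz _ _) _.
apply: (@le_trans _ _ (e ^+ 2 / (nsq y + 1) * (nsq y + 1))).
  by apply: ler_pM; rewrite ?nsq_ge0 ?h//; lra.
by rewrite divfK ?gt_eqF.
Qed.

(** Lower semicontinuity of the norm: 2 <f n, x> <= |f n|^2 + |x|^2, where the left side tends to 2
    |x|^2. *)
Lemma lims_nsq_le f x (C : R) : lims f x ->
  (forall e : R, 0 < e -> exists N, forall n, (N <= n)%N -> nsq (f n) <= C + e) ->
  nsq x <= C.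
Proof.
move=> fx fC; apply/ler_addgt0Pr => e e0.
have e2 : 0 < e / 4 by lra.
have e3 : 0 < e / 2 by lra.
have [N1 h1] := lims_ip x fx e2.
have [N2 h2] := fC _ e3.
have := h1 _ (leq_maxl N1 N2); have := h2 _ (leq_maxr N1 N2).
set n := maxn _ _; have := nsq_ge0 (f n - x); rewrite ler_norml /nsq !ipE.
rewrite (ipC x (f n)); lra.
Qed.

End RealInnerProduct.

(** * Positive contractions and square roots *)

(** The common source of convergence: it is applied to the scalar majorants of the square root
    iteration, to the norms of iterates of a contraction, and to the masses of increasing clopen
    sets. *)
Lemma monotone_bounded_cauchy {R : realType} (y : nat -> R) (C : R) :
  (forall n, y n <= y n.+1) -> (forall n, y n <= C) ->
  forall e : R, 0 < e -> exists N, forall m n, (N <= m)%N -> (N <= n)%N ->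
    `|y m - y n| <= e.
Proof.
move=> ym yC e e0.
have ymono : {homo y : m n / (m <= n)%N >-> m <= n} by apply/nondecreasing_seqP.
have hs : has_sup (range y).
  by split; [exists (y 0%N), 0%N | exists C => _ [n _ <-]].
have [_ [N _ <-] hN] := sup_adherent e0 hs.
have le_sup n : y n <= sup (range y) by apply: ub_le_sup; [case: hs | exists n].
exists N => m n Nm Nn; have := le_sup m; have := le_sup n.
have := ymono _ _ Nm; have := ymono _ _ Nn; rewrite ler_norml; lra.
Qed.

Lemma inv_nat_small {R : realType} (e : R) : 0 < e ->
  exists N, forall n, (N <= n)%N -> n.+1%:R^-1 <= e.
Proof.
move=> e0; exists (Num.trunc e^-1) => n Nn.
rewrite invf_ple ?posrE ?ltr0n//; apply: ltW.
by apply: lt_le_trans (truncnS_gt _) _; rewrite ler_nat ltnS.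
Qed.

Section Operators.
Context {R : realType} {H : hilbertSpace R}.
Implicit Types (x y z : H) (A B D N P S T V : H -> H).

Definition cont_op T := linear T /\
  exists C : R, 0 <= C /\ forall x, nsq (T x) <= C * nsq x.
Definition sym_op T := forall x y, ip (T x) y = ip x (T y).
Definition contr_op T := forall x, nsq (T x) <= nsq x.
Definition pos_op T := forall x, 0 <= ip (T x) x.
Definition commutes S T := forall x, S (T x) = T (S x).
(** [sac] stands for self-adjoint contraction; an [effect] is an operator with 0 <= T <= 1 in the
    order of quadratic forms. *)
Definition sac T := [/\ linear T, sym_op T & contr_op T].
Definition effect T :=
  [/\ linear T, sym_op T, pos_op T & forall x, ip (T x) x <= nsq x].
Definition proj_op P := [/\ linear P, sym_op P & forall x, P (P x) = P x].

Lemma lin_D T (lT : linear T) x y : T (x + y) = T x + T y.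
Proof. by rewrite -[x]scale1r lT !scale1r. Qed.

Lemma lin_0 T (lT : linear T) : T 0 = 0.
Proof. by apply: (addrI (T 0)); rewrite -(lin_D lT) !addr0. Qed.

Lemma lin_Zc T (lT : linear T) (c : Cx R) x : T (c *: x) = c *: T x.
Proof. by rewrite -[c *: x]addr0 lT (lin_0 lT) addr0. Qed.

Lemma lin_Z T (lT : linear T) a x : T (rscale a x) = rscale a (T x).
Proof. exact: lin_Zc. Qed.

Lemma lin_N T (lT : linear T) x : T (- x) = - T x.
Proof. by rewrite -scaleN1r (lin_Zc lT) scaleN1r. Qed.

Lemma lin_B T (lT : linear T) x y : T (x - y) = T x - T y.
Proof. by rewrite (lin_D lT) (lin_N lT). Qed.

Lemma linear_id : linear (fun x : H => x).
Proof. by []. Qed.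

Lemma linear_0 : linear (fun _ : H => 0 : H).
Proof. by move=> c x y; rewrite scaler0 addr0. Qed.

Lemma linear_D S T : linear S -> linear T -> linear (fun x => S x + T x).
Proof. by move=> lS lT c x y; rewrite lS lT scalerDr addrACA. Qed.

Lemma linear_B S T : linear S -> linear T -> linear (fun x => S x - T x).
Proof.
by move=> lS lT c x y; rewrite lS lT scalerBr opprD addrACA.
Qed.

Lemma linear_Zc (c : Cx R) T : linear T -> linear (fun x => c *: T x).
Proof. by move=> lT a x y; rewrite lT scalerDr !scalerA mulrC. Qed.

Lemma linear_Z a T : linear T -> linear (fun x => rscale a (T x)).
Proof. exact: linear_Zc. Qed.

Lemma linear_comp S T : linear S -> linear T -> linear (fun x => S (T x)).
Proof. by move=> lS lT c x y; rewrite lT lS. Qed.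

Lemma contr_cont T : linear T -> contr_op T -> cont_op T.
Proof. by move=> lT cT; split=> //; exists 1; split=> // x; rewrite mul1r. Qed.

Lemma sac_cont T : sac T -> cont_op T.
Proof. by case=> lT _ cT; exact: contr_cont. Qed.

Lemma cont_lims T f x : cont_op T -> lims f x -> lims (fun n => T (f n)) (T x).
Proof.
move=> [lT [C [C0 hC]]] fx e e0.
have C1 : 0 < C + 1 by lra.
have [|N hN] := fx (e / (C + 1)); first exact: divr_gt0.
exists N => n Nn; rewrite -(lin_B lT); apply: le_trans (hC _) _.
have := hN n Nn; have := nsq_ge0 (f n - x).
rewrite ler_pdivlMr// => h1 h2; nra.
Qed.

Lemma cont_comp S T : cont_op S -> cont_op T -> cont_op (fun x => S (T x)).
Proof.
move=> [lS [C [C0 hC]]] [lT [D [D0 hD]]]; split; first exact: linear_comp.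
exists (C * D); split; first exact: mulr_ge0.
move=> x; apply: le_trans (hC _) _; rewrite -mulrA; exact: ler_wpM2l.
Qed.

Lemma contD S T : cont_op S -> cont_op T -> cont_op (fun x => S x + T x).
Proof.
move=> [lS [C [C0 hC]]] [lT [D [D0 hD]]]; split; first exact: linear_D.
exists (2 * C + 2 * D); split; first by lra.
by move=> x; have := nsqD2 (S x) (T x); have := hC x; have := hD x; lra.
Qed.

Lemma contZc (c : Cx R) T : cont_op T -> cont_op (fun x => c *: T x).
Proof.
move=> [lT [D [D0 hD]]]; split; first exact: linear_Zc.
have c0 : 0 <= complex.Re c ^+ 2 + complex.Im c ^+ 2 by rewrite addr_ge0 ?sqr_ge0.
exists ((complex.Re c ^+ 2 + complex.Im c ^+ 2) * D); split; first exact: mulr_ge0.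
by move=> x; rewrite nsqZc -mulrA ler_wpM2l.
Qed.

Lemma cont_op0 : cont_op (fun _ : H => 0 : H).
Proof. by split; [exact: linear_0 | exists 0; split=> // x; rewrite /nsq ip0l mul0r]. Qed.

Lemma contB S T : cont_op S -> cont_op T -> cont_op (fun x => S x - T x).
Proof.
move=> cS cT; have := contD cS (contZc (-1) cT).
by congr cont_op; apply/funext => x; rewrite scaleN1r.
Qed.

Lemma contr_ip T x : contr_op T -> ip (T x) x <= nsq x.
Proof.
move=> cT; have := cT x; have := nsq_ge0 (x - T x).
by rewrite /nsq !ipE (ipC x); lra.
Qed.

(** |x - B^2 x|^2 = |x|^2 - 2|Bx|^2 + |B^2 x|^2 <= |x|^2 - |Bx|^2. *)
Lemma contr_subsq B : linear B -> sym_op B -> contr_op B ->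
  contr_op (fun x => x - B (B x)).
Proof.
move=> lB sB cB x; have := cB (B x); have := nsq_ge0 (B x).
by rewrite /nsq !ipE (ipC x) !sB; lra.
Qed.

Lemma sac_subsq B : sac B -> sac (fun x => x - B (B x)).
Proof.
move=> [lB sB cB]; split; last exact: contr_subsq.
  exact: linear_B linear_id (linear_comp lB lB).
by move=> x y; rewrite !ipE !sB.
Qed.

Lemma proj_nsq P x : proj_op P -> nsq (P x) = ip (P x) x.
Proof. by move=> [_ sP PP]; rewrite /nsq -sP PP. Qed.

Lemma proj_contr P : proj_op P -> contr_op P.
Proof.
move=> pP x; have := proj_nsq x pP; have := nsq_ge0 (x - P x).
by rewrite /nsq !ipE (ipC x); lra.
Qed.

Lemma proj_sac P : proj_op P -> sac P.
Proof. by move=> pP; have [lP sP _] := pP; split=> //; exact: proj_contr. Qed.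

Lemma proj_cont P : proj_op P -> cont_op P.
Proof. by move/proj_sac/sac_cont. Qed.

(* <Ax - x, A(Ax - x)> >= 0 gives |Ax|^2 <= <Ax, x>. *)
Lemma effect_nsq A x : effect A -> nsq (A x) <= ip (A x) x.
Proof.
move=> [lA sA pA A1]; have := pA (x - A x); have := A1 (A x).
by rewrite (lin_B lA) /nsq !ipE !sA; lra.
Qed.

Lemma effect_contr A : effect A -> contr_op A.
Proof.
by move=> eA x; apply: le_trans (effect_nsq x eA) _; case: eA.
Qed.

Lemma effect_sac A : effect A -> sac A.
Proof. by move=> eA; have [lA sA _ _] := eA; split=> //; exact: effect_contr. Qed.

Lemma op_limit (f : nat -> H -> H) : (forall x, cauchys (f^~ x)) ->
  exists T, forall x, lims (f^~ x) (T x).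
Proof.
move=> cf; have /choice[T hT] x := cauchys_lims (cf x).
by exists T.
Qed.

(** * Properties inherited by strong limits of operators *)

Section Limits.
Variables (f : nat -> H -> H) (T : H -> H).
Hypothesis fT : forall x, lims (f^~ x) (T x).

Lemma lim_linear : (forall n, linear (f n)) -> linear T.
Proof.
move=> lf c x y; apply: (lims_unique (fT _)).
apply: (eq_lims (fun n => esym (lf n c x y))).
by apply: limsD => //; exact: limsZ.
Qed.

Lemma lim_sym : (forall n, sym_op (f n)) -> sym_op T.
Proof.
move=> sf x y; apply/eqP; rewrite -subr_eq0 -normr_eq0 eq_le normr_ge0 andbT.
apply/ler_addgt0Pr => e e0; have e2 : 0 < e / 2 by lra.
have [N1 h1] := lims_ip y (fT x) e2.
have [N2 h2] := lims_ip x (fT y) e2.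
have := h1 _ (leq_maxl N1 N2); have := h2 _ (leq_maxr N1 N2).
rewrite (ipC _ x) -sf (ipC (T y)) add0r !ler_norml; lra.
Qed.

Lemma lim_contr : (forall n, contr_op (f n)) -> contr_op T.
Proof.
move=> cf x; apply: lims_nsq_le (fT x) _ => e e0.
by exists 0%N => n _; apply: le_trans (cf n x) _; rewrite lerDl ltW.
Qed.

Lemma lim_commutes S : cont_op S -> (forall n, commutes S (f n)) ->
  commutes S T.
Proof.
move=> cS Sf x; apply: lims_unique (fT _).
exact: eq_lims (fun n => Sf n x) (cont_lims cS (fT x)).
Qed.

End Limits.

(** * The positive square root of B^2 for a self-adjoint contraction B *)

Section SquareRoot.
Variable B : H -> H.
Hypothesis sB : sac B.

(* The limit Y solves 2Y = (1 - B^2) + Y^2, so that 1 - Y is a square root of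
   B^2. *)
Fixpoint sqrt_iter n : H -> H :=
  if n is n'.+1 then
    fun x => rscale 2^-1 (x - B (B x) + sqrt_iter n' (sqrt_iter n' x))
  else fun=> 0.

(* [sqrt_iter] run on the number 1: a majorant of its norms and increments. *)
Fixpoint sqrt_majorant n : R :=
  if n is n'.+1 then (1 + sqrt_majorant n' ^+ 2) / 2 else 0.

Local Notation Y := sqrt_iter.
Local Notation y := sqrt_majorant.

Lemma sqrt_majorant_le1 n : 0 <= y n <= 1.
Proof. by elim: n => [|n IH] /=; [rewrite lexx ler01 | nra]. Qed.

Lemma sqrt_majorantS n : y n <= y n.+1.
Proof.
have /= := sqrt_majorant_le1 n; move: (y n) => t h.
have := sqr_ge0 (1 - t); lra.
Qed.

Lemma sqrt_iter_linear n : linear (Y n).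
Proof.
have [lB _ _] := sB; elim: n => [|n IH] /=; first exact: linear_0.
apply: linear_Z; apply: linear_D; last exact: linear_comp.
exact: linear_B linear_id (linear_comp lB lB).
Qed.

Lemma sqrt_iter_sym n : sym_op (Y n).
Proof.
have [_ yB _] := sB.
elim: n => [|n IH] x z /=; first by rewrite !ipE.
by rewrite !ipE !yB !IH.
Qed.

Lemma sqrt_iter_commutes S n : linear S -> commutes S B -> commutes S (Y n).
Proof.
move=> lS SB; elim: n => [|n IH] x /=; first exact: lin_0.
by rewrite (lin_Z lS) (lin_D lS) (lin_B lS) !SB !IH.
Qed.

Lemma sqrt_iter_comm m n : commutes (Y m) (Y n).
Proof.
apply: sqrt_iter_commutes; first exact: sqrt_iter_linear.
by move=> x; rewrite -sqrt_iter_commutes//; case: sB.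
Qed.

Lemma sqrt_iter_bound n x : nsq (Y n x) <= y n ^+ 2 * nsq x.
Proof.
have [lB yB cB] := sB.
elim: n x => [|n IH] x /=; first by rewrite /nsq ip0l expr0n mul0r.
have /andP[y0 y1] := sqrt_majorant_le1 n.
rewrite nsqZ exprMn [leRHS]mulrAC mulrC ler_wpM2r ?sqr_ge0//.
apply: nsq_triangle; rewrite ?nsq_ge0// ?sqr_ge0//.
  by rewrite expr1n mul1r; exact: contr_subsq.
apply: le_trans (IH _) _; rewrite -[y n ^+ 2 ^+ 2]/(y n ^+ 2 * y n ^+ 2) -mulrA.
by rewrite ler_wpM2l ?sqr_ge0.
Qed.

(** The iterates commute, so 2 (Y_(n+2) - Y_(n+1)) = Y_(n+1)^2 - Y_n^2 factors as (Y_(n+1) +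
    Y_n)(Y_(n+1) - Y_n), and the scalar recursion factors in the same way. *)
Lemma sqrt_iter_incr n x :
  nsq (Y n.+1 x - Y n x) <= (y n.+1 - y n) ^+ 2 * nsq x.
Proof.
elim: n x => [|n IH] x.
  rewrite [Y 0 x]/= [y 0]/= !subr0; exact: sqrt_iter_bound.
have /andP[y0 y1] := sqrt_majorant_le1 n.
have /andP[y0' y1'] := sqrt_majorant_le1 n.+1.
have lY k := sqrt_iter_linear k.
set d := Y n.+1 x - Y n x.
have -> : Y n.+2 x - Y n.+1 x = rscale 2^-1 (Y n.+1 d + Y n d).
  rewrite /d !(lin_B (lY _)) (sqrt_iter_comm n.+1 n) -[Y n.+2 x]/(rscale _ _).
  rewrite {3}[Y n.+1 x]/=.
  by apply: ip_ext => t; rewrite !ipE; lra.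
have -> : y n.+2 - y n.+1 = 2^-1 * ((y n.+1 + y n) * (y n.+1 - y n)).
  rewrite -[y n.+2]/((1 + y n.+1 ^+ 2) / 2) {2}[y n.+1]/=; by field.
rewrite nsqZ exprMn -[leRHS]mulrA ler_wpM2l ?sqr_ge0//.
rewrite exprMn -[leRHS]mulrA.
apply: (@le_trans _ _ ((y n.+1 + y n) ^+ 2 * nsq d)).
  by apply: nsq_triangle; rewrite ?nsq_ge0//; exact: sqrt_iter_bound.
by rewrite ler_wpM2l ?sqr_ge0// IH.
Qed.

Lemma sqrt_iter_dist m k x :
  nsq (Y (m + k)%N x - Y m x) <= (y (m + k)%N - y m) ^+ 2 * nsq x.
Proof.
have ymono k' : y m <= y (m + k')%N.
  elim: k' => [|k' IH]; rewrite ?addn0// addnS.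
  exact: le_trans IH (sqrt_majorantS _).
elim: k => [|k IH]; first by rewrite addn0 !subrr /nsq ip0l expr0n mul0r.
rewrite addnS.
have -> : Y (m + k).+1 x - Y m x =
    (Y (m + k).+1 x - Y (m + k)%N x) + (Y (m + k)%N x - Y m x).
  by rewrite addrA subrK.
have -> : y (m + k).+1 - y m =
    (y (m + k).+1 - y (m + k)%N) + (y (m + k)%N - y m) by ring.
apply: nsq_triangle; rewrite ?nsq_ge0 ?subr_ge0//.
  exact: sqrt_majorantS.
exact: sqrt_iter_incr.
Qed.

Lemma sqrt_iter_cauchy x : cauchys (Y^~ x).
Proof.
move=> e e0; have x1 : 0 < nsq x + 1 by have := nsq_ge0 x; lra.
pose r := Num.sqrt (e / (nsq x + 1)).
have r0 : 0 < r by rewrite sqrtr_gt0 divr_gt0.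
have r2 : r ^+ 2 = e / (nsq x + 1) by rewrite sqr_sqrtr// divr_ge0// ltW.
have [||N hN] := @monotone_bounded_cauchy _ y 1 _ _ r r0.
- exact: sqrt_majorantS.
- by move=> n; have /andP[] := sqrt_majorant_le1 n.
exists N => m n Nm Nn.
have main i j : (N <= i)%N -> (i <= j)%N -> nsq (Y j x - Y i x) <= e.
  move=> Ni ij; rewrite -(subnKC ij); apply: le_trans (sqrt_iter_dist _ _ _) _.
  rewrite subnKC//; have Nj := leq_trans Ni ij; have := hN _ _ Nj Ni.
  rewrite -[X in _ <= X]ger0_norm ?(ltW r0)// -ler_sqr ?nnegrE//.
  rewrite !real_normK ?num_real// r2 ler_pdivlMr// => h.
  apply: le_trans h; rewrite ler_wpM2l ?sqr_ge0//; lra.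
have [mn|/ltnW nm] := leqP m n; first by rewrite nsqBC; exact: main.
exact: main.
Qed.

(** The root is 1 - T for the strong limit T of the iterates. It is positive because T is a
    contraction, and it commutes with whatever commutes with B because every iterate is a polynomial
    in B. *)
Lemma exists_sqrt_sq : exists A, [/\ sac A, pos_op A,
  forall x, A (A x) = B (B x) &
  forall S, cont_op S -> commutes S B -> commutes S A].
Proof.
have [lB yB cB] := sB.
have [T YT] := op_limit sqrt_iter_cauchy.
have lT : linear T := lim_linear YT sqrt_iter_linear.
have sT : sym_op T := lim_sym YT sqrt_iter_sym.
have cY n : contr_op (Y n).
  move=> x; apply: le_trans (sqrt_iter_bound n x) _; rewrite ler_piMl ?nsq_ge0//.
  have := sqrt_majorant_le1 n; nra.
have cT : contr_op T := lim_contr YT cY.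
have TE x : rscale 2 (T x) = x - B (B x) + T (T x).
  have h : lims (fun n => x - B (B x) + Y n (Y n x)) (x - B (B x) + T (T x)).
    apply: limsD; first exact: lims_cst.
    (* Y_n Y_n x - T T x = Y_n (Y_n x - T x) + (Y_n T x - T T x), and the Y_n are contractions. *)
    move=> e e0; have e4 : 0 < e / 4 by lra.
    have [N1 h1] := YT x _ e4; have [N2 h2] := YT (T x) _ e4.
    exists (maxn N1 N2) => n; rewrite geq_max => /andP[n1 n2].
    apply: le_trans (nsqB2 _ (Y n (T x)) _) _.
    rewrite -(lin_B (sqrt_iter_linear n)).
    have := cY n (Y n x - T x); have := h1 n n1; have := h2 n n2; lra.
  apply: lims_unique h; have := limsZ (2%:C%C : Cx R) (lims_shift 1 (YT x)).
  apply: eq_lims => n; rewrite addn1 /= -/(rscale _ _) -/(rscale _ _).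
  by apply: ip_ext => t; rewrite !ipE; field.
have AA x : (x - T x) - T (x - T x) = B (B x).
  have := congr1 (fun v => ip v) (TE x) => h.
  apply: ip_ext => t; have := congr1 (fun f => f t) h.
  by rewrite /= (lin_B lT) !ipE; lra.
have sA : sym_op (fun x => x - T x) by move=> x z; rewrite !ipE sT.
exists (fun x => x - T x); split=> //.
- split=> //; first exact: linear_B linear_id lT.
  by move=> x; rewrite /nsq sA AA -yB; exact: cB.
- by move=> x; rewrite !ipE subr_ge0; exact: contr_ip.
- move=> S cS SB x; have [lS _] := cS; rewrite (lin_B lS).
  congr (_ - _); apply: (lim_commutes YT) => // n.
  exact: sqrt_iter_commutes.
Qed.

End SquareRoot.

End Operators.

(** * Kernel projections and binary digits *)

Section KernelProjection.
Context {R : realType} {H : hilbertSpace R}.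
Implicit Types (x y z : H) (A B D N P S T V : H -> H).

Lemma linear_iter D n : linear D -> linear (iter n D).
Proof.
move=> lD; elim: n => [|n IH]; first exact: linear_id.
exact: linear_comp lD IH.
Qed.

Lemma sym_iter D n : sym_op D -> sym_op (iter n D).
Proof. by move=> sD; elim: n => //= n IH x y; rewrite sD IH -iterSr. Qed.

Lemma ip_iter D m n x y : sym_op D ->
  ip (iter m D x) (iter n D y) = ip (iter (m + n) D x) y.
Proof. by move=> sD; rewrite -sym_iter// addnC iterD. Qed.

(** Even powers make every inner product a squared norm: <D^(2i) x, D^(2j) x> = |D^(i+j) x|^2, which
    decreases in i + j. *)
Lemma iter_even_cauchy D x : sac D -> cauchys (fun n => iter (n + n) D x).
Proof.
move=> [lD sD cD] e e0; have e2 : 0 < e / 2 by lra.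
pose a n := - nsq (iter n D x).
have [||N hN] := @monotone_bounded_cauchy _ a 0 _ _ _ e2.
- by move=> n; rewrite /a lerN2; exact: cD.
- by move=> n; rewrite /a oppr_le0 nsq_ge0.
exists N => m n Nm Nn.
have aE i j : ip (iter (i + i) D x) (iter (j + j) D x) = - a (i + j)%N.
  by rewrite /a opprK /nsq !(ip_iter _ _ _ _ sD) addnACA.
rewrite /nsq !ipE !aE (addnC n m).
have Nk i j : (N <= i)%N -> (N <= i + j)%N by move=> h; rewrite (leq_trans h) ?leq_addr.
have := hN _ _ (Nk _ m Nm) (Nk _ n Nm); have := hN _ _ (Nk _ n Nn) (Nk _ n Nm).
rewrite !ler_norml; lra.
Qed.

(* The projection is the strong limit of the powers (1 - N^2)^(2n). *)
Lemma exists_kernel_proj N : sac N -> exists P, [/\ proj_op P,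
  forall x, N (P x) = 0,
  forall x, N x = 0 -> P x = x,
  forall S, cont_op S -> commutes S N -> commutes S P &
  forall V, cont_op V -> (forall x, V (N x) = 0) -> forall x, V (P x) = V x].
Proof.
move=> sN; have [lN yN cN] := sN.
pose D x := x - N (N x); have sD : sac D := sac_subsq sN.
have [lD yD cD] := sD.
pose f n := iter (n + n) D.
have [P fP] := op_limit (fun x => iter_even_cauchy x sD).
have cP : contr_op P.
  apply: (lim_contr fP) => n x; elim: (n + n)%N => [|k IH] //=.
  exact: le_trans (cD _) IH.
have fix_P x : D (D x) = x -> P x = x.
  move=> Dx; apply: lims_unique (fP x) _.
  apply: eq_lims (@lims_cst _ _ x) => n.
  by elim: n => //= n IH; rewrite addnS /= -IH Dx.
have DDP x : D (D (P x)) = P x.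
  apply: lims_unique (lims_shift 1 (fP x)).
  have := cont_lims (cont_comp (sac_cont sD) (sac_cont sD)) (fP x).
  by apply: eq_lims => n; rewrite addn1 addnS.
have pP : proj_op P.
  split; last by move=> x; exact: fix_P.
  - by apply: (lim_linear fP) => n; exact: linear_iter.
  - by apply: (lim_sym fP) => n; exact: sym_iter.
exists P; split=> //.
- move=> x; set y := P x; have DDy : D (D y) = y := DDP x.
  (* D D y = y forces |Dy| = |y|, whereas |Dy|^2 = |y|^2 - 2|Ny|^2 + |N^2 y|^2 <= |y|^2 - |Ny|^2;
     hence N y = 0. *)
  have h1 : nsq (D y) = nsq y.
    by apply/eqP; rewrite eq_le cD -{1}DDy cD.
  have h2 := cN (N y); have h3 := nsq_ge0 (N y).
  apply: nsq_eq0; move: h1; rewrite /D; move: h2 h3.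
  rewrite /nsq !ipE (ipC y) !yN; lra.
- by move=> x Nx; apply: fix_P; rewrite /D !Nx (lin_0 lN) !subr0 Nx (lin_0 lN) subr0.
- move=> S cS SN; have [lS _] := cS; apply: (lim_commutes fP) => // n x.
  by elim: (n + n)%N => //= k IH; rewrite {1}/D (lin_B lS) !SN IH.
(* V N = 0 gives V D = V, so V takes the value V x at every iterate of x. *)
- move=> V cV VN x; have [lV _] := cV.
  apply: (@lims_unique _ _ (fun=> V x)); last exact: lims_cst.
  apply: eq_lims (cont_lims cV (fP x)) => n.
  by elim: (n + n)%N => //= k IH; rewrite {1}/D (lin_B lV) VN subr0.
Qed.

(* [P] is the spectral projection of [A] for [1/2, 1]: with B = 2A - 1 and
   |B| the square root of B^2, it is the projection onto the kernel of the
   negative part (|B| - B)/2. *)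
Lemma exists_digit A : effect A -> exists P, [/\ proj_op P,
  effect (fun x => rscale 2 (A x) - P x) &
  forall S, cont_op S -> commutes S A -> commutes S P].
Proof.
move=> eA; have [lA yA pA A1] := eA.
pose B x := rscale 2 (A x) - x.
have lB : linear B by apply: linear_B linear_id; exact: linear_Z.
have yB : sym_op B by move=> x y; rewrite /B !ipE yA.
have cB : contr_op B.
  move=> x; have := effect_nsq x eA; rewrite /B /nsq !ipE (ipC x).
  lra.
have defB x : B x = rscale 2 (A x) - x by [].
clearbody B.
have [M [sM pM MM cM]] := exists_sqrt_sq (And3 lB yB cB).
have [lM yM contrM] := sM.
pose N x := rscale 2^-1 (M x - B x).
have MB x : M (B x) = B (M x).
  by rewrite -(cM B) //; exact: sac_cont (And3 lB yB cB).
have sN : sac N.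
  split.
  - by apply: linear_Z; exact: linear_B.
  - by move=> x y; rewrite /N !ipE yM yB.
  - move=> x; rewrite /N nsqZ -nsqN opprB.
    have := nsqD2 (B x) (- M x); rewrite nsqN; have := cB x; have := contrM x.
    lra.
have [P [pP NP PN cP _]] := exists_kernel_proj sN.
have [lP yP PP] := pP.
have MP x : M (P x) = B (P x).
  have := NP x; rewrite /N => h; apply: ip_ext => t.
  by have := congr1 (fun v => ip v t) h; rewrite /= !ipE; lra.
have PB x : P (B x) = B (P x).
  rewrite -(cP B) //; first exact: sac_cont (And3 lB yB cB).
  by move=> y; rewrite /N (lin_Z lB) (lin_B lB) MB.
have PM x : P (M x) = M (P x).
  rewrite -(cP M) //; first exact: sac_cont.
  by move=> y; rewrite /N (lin_Z lM) (lin_B lM) MB.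
(* N (M + B) = (M^2 - B^2) / 2 = 0, so the range of M + B lies in the kernel of N. *)
have P_MB x : P (M x + B x) = M x + B x.
  apply: PN; rewrite /N (lin_D lM) (lin_D lB) MM MB.
  by apply: ip_ext => t; rewrite !ipE; lra.
have ip_MP x : ip (M (P x)) x = ip (M (P x)) (P x).
  by rewrite -yP PM PP.
have ip_MPc x : ip (M x) (x - P x) = ip (M (x - P x)) (x - P x).
  by rewrite (lin_B lM) !ipE -!yP !PM !PP; lra.
(* B equals M on the range of P and, M + B being zero there, -M on its complement. *)
have BE x : ip (B x) x = ip (M (P x)) (P x) - ip (M (x - P x)) (x - P x).
  rewrite -ip_MP -ip_MPc !ipE.
  have := congr1 (fun v => ip v x) (P_MB x); rewrite (lin_D lP) PB PM MP !ipE.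
  rewrite -(yP (M x)) PM MP; lra.
(* Since 2A = B + 1, the form of 2A - P at x is <MPx, Px> + (|x|^2 - <Px, x>) - <M(x - Px), x - Px>.
   The next two bounds and M >= 0 place it between 0 and |x|^2. *)
have MPle x : ip (M (P x)) (P x) <= ip (P x) x.
  by rewrite -(proj_nsq _ pP); exact: contr_ip.
have MPcle x : ip (M (x - P x)) (x - P x) <= nsq x - ip (P x) x.
  have := contr_ip (x - P x) contrM; have := proj_nsq x pP.
  by rewrite /nsq !ipE (ipC x (P x)); lra.
have AE x : 2 * ip (A x) x = ip (B x) x + nsq x by rewrite defB /nsq !ipE; lra.
exists P; split=> //.
- split.
  + by apply: linear_B lP; exact: linear_Z.
  + by move=> x y; rewrite !ipE yA yP.
  + move=> x; rewrite !ipE AE BE; have := pM (P x); have := MPcle x; lra.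
  + move=> x; rewrite !ipE AE BE; have := pM (x - P x); have := MPle x; lra.
- move=> S cS SA; have [lS _] := cS.
  have SB : commutes S B by move=> x; rewrite !defB (lin_B lS) (lin_Z lS) SA.
  apply: cP => // x; rewrite /N (lin_Z lS) (lin_B lS) SB.
  by rewrite (cM _ cS SB).
Qed.

(** The remainder after n digits is 2^-n times an effect, so the error estimate is just
    contractivity of effects. *)
Lemma binary_digits A : effect A -> exists P : nat -> H -> H,
  [/\ forall n, proj_op (P n),
      forall n S, cont_op S -> commutes S A -> commutes S (P n) &
      forall n x, nsq (A x - \sum_(k < n) rscale (2^-1 ^+ k.+1) (P k x))
                    <= (2^-1 ^+ n) ^+ 2 * nsq x].
Proof.
move=> eA.
(* The digit is chosen for every operator, arbitrarily when it is not an effect, so that the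
   remainders can be defined by plain iteration before they are known to be effects. *)
have /choice[dig hdig] (T : H -> H) : exists P, effect T -> [/\ proj_op P,
    effect (fun x => rscale 2 (T x) - P x) &
    forall S, cont_op S -> commutes S T -> commutes S P].
  have [eT|nT] := pselect (effect T); last by exists id.
  by have [P hP] := exists_digit eT; exists P.
pose rest n := iter n (fun T x => rscale 2 (T x) - dig T x) A.
have eR n : effect (rest n).
  by elim: n => [//|n IH]; have [_ ? _] := hdig _ IH.
exists (fun n => dig (rest n)); split.
- by move=> n; have [] := hdig _ (eR n).
- move=> n S cS SA; have [_ _] := hdig _ (eR n); apply=> //.
  have [lS _] := cS; elim: n => //= n IH x.
  rewrite (lin_B lS) (lin_Z lS) -IH; congr (_ - _).
  by have [_ _] := hdig _ (eR n); apply.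
- move=> n x.
  have -> : A x - \sum_(k < n) rscale (2^-1 ^+ k.+1) (dig (rest k) x) =
      rscale (2^-1 ^+ n) (rest n x).
    elim: n => [|n IH].
      by rewrite big_ord0 subr0 expr0; apply: ip_ext => t; rewrite !ipE mul1r.
    rewrite big_ord_recr /= opprD addrA IH.
    by apply: ip_ext => t; rewrite !ipE exprS; field.
  by rewrite nsqZ ler_wpM2l ?sqr_ge0//; exact: effect_contr.
Qed.

End KernelProjection.

(** * Commuting projections and the Cantor space *)

(* Clopen sets of [nat -> bool] are represented by Boolean terms, so that
   commuting projections can be substituted for the coordinates. *)
Inductive clopen_term :=
  | CBit of nat
  | CNeg of clopen_term
  | CAnd of clopen_term & clopen_term.

Fixpoint cmem (c : clopen_term) (p : nat -> bool) : bool :=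
  match c with
  | CBit n => p n
  | CNeg c => ~~ cmem c p
  | CAnd c d => cmem c p && cmem d p
  end.

Fixpoint cdepth (c : clopen_term) : nat :=
  match c with
  | CBit n => n.+1
  | CNeg c => cdepth c
  | CAnd c d => maxn (cdepth c) (cdepth d)
  end.

Definition CFalse := CAnd (CBit 0) (CNeg (CBit 0)).
Definition COr c d := CNeg (CAnd (CNeg c) (CNeg d)).
(** The negated factor comes first so that the projection of [CDiff c d] computes to Q c x - Q d (Q
    c x). *)
Definition CDiff c d := CAnd (CNeg d) c.

Lemma cmem_False p : cmem CFalse p = false.
Proof. by rewrite /= andbN. Qed.

Lemma cmem_Or c d p : cmem (COr c d) p = cmem c p || cmem d p.
Proof. by rewrite /= negb_and !negbK. Qed.

Lemma cmem_Diff c d p : cmem (CDiff c d) p = cmem c p && ~~ cmem d p.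
Proof. by rewrite /= andbC. Qed.

Definition csub c d := forall p, cmem c p -> cmem d p.

Lemma csub_homo (C : nat -> clopen_term) : (forall n, csub (C n) (C n.+1)) ->
  forall m n, (m <= n)%N -> csub (C m) (C n).
Proof.
move=> CS m n mn; rewrite -(subnKC mn).
elim: (n - m)%N => [|k IH] p; first by rewrite addn0.
by move/IH; rewrite addnS; exact: CS.
Qed.

Fixpoint COrs (C : nat -> clopen_term) n : clopen_term :=
  if n is n'.+1 then COr (COrs C n') (C n') else CFalse.

Lemma cmem_Ors C n p : cmem (COrs C n) p <-> exists2 k, (k < n)%N & cmem (C k) p.
Proof.
elim: n => [|n IH]; first by rewrite cmem_False; split=> // -[].
rewrite [COrs _ _]/= cmem_Or; split.
  case/orP => [/IH[k kn pk]|pn]; first by exists k => //; exact: ltnW.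
  by exists n.
case=> k; rewrite ltnS leq_eqVlt => /orP[/eqP -> ->|kn pk]; first exact: orbT.
by apply/orP; left; apply/IH; exists k.
Qed.

Lemma clopen_cmem c : @clopen cantor_space [set p : nat -> bool | cmem c p].
Proof.
have clopen_bit n : @clopen cantor_space [set p : nat -> bool | p n].
  rewrite (_ : [set p : nat -> bool | p n] = @proj nat (fun=> bool) n @^-1` [set true]).
    apply: preimage_clopen; last exact: proj_continuous.
    by split; [exact: discrete_open | exact: discrete_closed].
  by apply/seteqP; split=> p /=; rewrite /proj /=; case: (p n).
elim: c => [n|c IH|c IHc d IHd]; first exact: clopen_bit.
- rewrite (_ : mkset _ = ~` [set p | cmem c p]); last first.
    by apply/seteqP; split=> p /= /negP.
  exact: (@clopenC cantor_space _ setT IH).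
- rewrite (_ : mkset _ = [set p | cmem c p] `&` [set p | cmem d p]); last first.
    by apply/seteqP; split=> p /=; [move/andP | move=> [-> ->]].
  exact: clopenI.
Qed.

(** A finite subcover of a clopen set by an increasing sequence is contained in its member of
    largest index. Countable additivity rests on this compactness. *)
Lemma clopen_compact c (C : nat -> clopen_term) :
  (forall n, csub (C n) (C n.+1)) -> (forall p, cmem c p -> exists n, cmem (C n) p) ->
  exists n, csub c (C n).
Proof.
move=> Cmono cC.
have : compact ([set p | cmem c p] : set cantor_space).
  apply: subclosed_compact (@cantor_space_compact) _ => //.
  by have [] := clopen_cmem c.
rewrite compact_cover => /(_ _ [set: nat] (fun n => [set p | cmem (C n) p])) [].
- by move=> n _; have [] := clopen_cmem (C n).
- by move=> p /cC[n pn]; exists n.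
move=> D _ cD; exists (\max_(n <- finmap.enum_fset D) n)%N => p /cD[n /= nD].
by apply: (csub_homo Cmono); exact: leq_bigmax_seq.
Qed.

Section CommutingProjections.
Context {R : realType} {H : hilbertSpace R}.
Implicit Types (x y z : H) (xs : seq H) (S T : set (nat -> bool)).
Variable r : nat -> H -> H.
Hypothesis r_proj : forall n, proj_op (r n).
Hypothesis r_comm : forall m n, commutes (r m) (r n).

Fixpoint cproj (c : clopen_term) : H -> H :=
  match c with
  | CBit n => r n
  | CNeg c => fun x => x - cproj c x
  | CAnd c d => fun x => cproj c (cproj d x)
  end.

Local Notation Q := cproj.

Lemma cproj_commutes (S : H -> H) c : linear S -> (forall n, commutes S (r n)) ->
  commutes S (Q c).
Proof.
move=> lS Sr; elim: c => [n|c IH|c IHc d IHd] x /=; first exact: Sr.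
  by rewrite (lin_B lS) IH.
by rewrite IHc IHd.
Qed.

Lemma cproj_linear c : linear (Q c).
Proof.
elim: c => [n|c IH|c IHc d IHd] /=; first by case: (r_proj n).
  exact: linear_B linear_id IH.
exact: linear_comp.
Qed.

Lemma cprojC c d : commutes (Q c) (Q d).
Proof.
apply: cproj_commutes (cproj_linear c) _ => n x; symmetry.
apply: cproj_commutes => [|m]; first by case: (r_proj n).
exact: r_comm.
Qed.

Lemma cproj_proj c : proj_op (Q c).
Proof.
split; first exact: cproj_linear.
- elim: c => [n|c IH|c IHc d IHd] x y /=; first by case: (r_proj n).
    by rewrite !ipE IH.
  by rewrite cprojC IHd IHc.
- elim: c => [n|c IH|c IHc d IHd] x /=; first by case: (r_proj n).
    by rewrite (lin_B (cproj_linear c)) IH subrr subr0.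
  by rewrite (cprojC d c) IHc IHd.
Qed.

Lemma cproj_contr c : contr_op (Q c).
Proof. exact: proj_contr (cproj_proj c). Qed.

Lemma cproj_eigen c p x :
  (forall n, (n < cdepth c)%N -> r n x = if p n then x else 0) ->
  Q c x = if cmem c p then x else 0.
Proof.
elim: c => [n|c IH|c IHc d IHd] /= hx; first by rewrite hx.
  by rewrite IH//; case: (cmem c p); rewrite ?subrr ?subr0.
rewrite IHd; last by move=> n nd; apply: hx; rewrite leq_max nd orbT.
case: (cmem d p); last by rewrite (lin_0 (cproj_linear c)) andbF.
by rewrite andbT IHc// => n nc; apply: hx; rewrite leq_max nc.
Qed.

(** Boolean identities pass to the projections through this fact. Splitting x along finitely many
    coordinates writes it as a sum of joint eigenvectors, on each of which Q c acts as the truth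
    value of c at some point. *)
Lemma cproj_empty c x : (forall p, ~~ cmem c p) -> Q c x = 0.
Proof.
move=> c0.
(* The coordinates from k up to the depth of c already act on y as the bits of p; each step splits y
   along one more coordinate, until k = 0. *)
suff main k p y : (forall n, (k <= n < cdepth c)%N -> r n y = if p n then y else 0) ->
    Q c y = 0.
  apply: (main (cdepth c) (fun=> false)) => n /andP[h1 h2].
  by move: (leq_ltn_trans h1 h2); rewrite ltnn.
elim: k p y => [|k IH] p y hy.
  by rewrite (@cproj_eigen _ p) ?(negbTE (c0 p))// => n nc; exact: hy.
have [lr _ rr] := r_proj k.
have step b z : r k z = (if b then z else 0) ->
    (forall n, (k < n < cdepth c)%N -> r n z = if p n then z else 0) -> Q c z = 0.
  move=> kz nz; apply: (IH (fun n => if n == k then b else p n)) => n /andP[kn nc].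
  have [->//|nk] := eqVneq n k; apply: nz; rewrite nc andbT.
  by rewrite ltn_neqAle eq_sym nk.
have -> : y = r k y + (y - r k y) by rewrite addrC subrK.
rewrite (lin_D (cproj_linear c)) (step true) ?add0r//.
- apply: (step false); first by rewrite (lin_B lr) rr subrr.
  move=> n nc; have [lrn _ _] := r_proj n; rewrite (lin_B lrn) -r_comm hy//.
  by case: (p n); rewrite ?(lin_0 lr) ?subrr.
- by move=> n nc; rewrite -r_comm hy//; case: (p n); rewrite ?(lin_0 lr).
Qed.

Lemma cproj_sub c d x : csub c d -> Q d (Q c x) = Q c x.
Proof.
move=> cd; have : Q (CDiff c d) x = 0.
  by apply: cproj_empty => p; rewrite cmem_Diff; apply/negP => /andP[/cd ->].
by move=> /= /eqP; rewrite subr_eq0 => /eqP.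
Qed.

Definition mass (xs : seq H) c : R := \sum_(x <- xs) nsq (Q c x).

Lemma mass_mono xs c d : csub c d -> mass xs c <= mass xs d.
Proof.
move=> cd; apply: ler_sum => x _; rewrite -(cproj_sub x cd) cprojC.
exact: cproj_contr.
Qed.

Lemma mass_False xs : mass xs CFalse = 0.
Proof.
rewrite /mass big1// => x _; rewrite cproj_empty ?/nsq ?ip0l// => p.
by rewrite cmem_False.
Qed.

(** Pythagoras for Q d x = Q c (Q d x) + (Q d x - Q c (Q d x)). *)
Lemma mass_Diff xs c d : csub c d -> mass xs d = mass xs c + mass xs (CDiff d c).
Proof.
move=> cd; rewrite /mass -big_split /=; apply: eq_bigr => x _.
have /= := cproj_sub x cd; rewrite cprojC => <-.
have := proj_nsq (Q d x) (cproj_proj c).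
by rewrite /nsq !ipE (ipC (Q d x) (Q c _)); lra.
Qed.

Lemma mass_Or xs c d : mass xs (COr c d) <= mass xs c + mass xs d.
Proof.
rewrite (@mass_Diff _ c); last by move=> p pc; rewrite cmem_Or pc.
rewrite lerD2l; apply: mass_mono => p.
by rewrite cmem_Diff cmem_Or => /andP[/orP[->|]].
Qed.

Lemma mass_Ors xs C n : mass xs (COrs C n) <= \sum_(k < n) mass xs (C k).
Proof.
elim: n => [|n IH]; first by rewrite big_ord0 mass_False.
by rewrite big_ord_recr /=; apply: le_trans (mass_Or _ _ _) _; rewrite lerD2r.
Qed.

Lemma mass1_le x xs c : x \in xs -> mass [:: x] c <= mass xs c.
Proof.
move=> xxs; rewrite /mass big_seq1 (big_rem x)//= lerDl.
by apply: sumr_ge0 => y _; exact: nsq_ge0.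
Qed.

(* The outer mass of S is at most e; an open set is the union of an increasing
   sequence of clopen sets. *)
Definition small xs (S : set (nat -> bool)) (e : R) := exists C : nat -> clopen_term,
  [/\ forall n, csub (C n) (C n.+1), forall p, S p -> exists n, cmem (C n) p &
      forall n, mass xs (C n) <= e].

Lemma small_le xs S T e e' : small xs T e -> S `<=` T -> e <= e' -> small xs S e'.
Proof.
move=> [C [Cm TC Ce]] ST ee'; exists C; split=> //.
  by move=> p /ST/TC.
by move=> n; exact: le_trans (Ce n) ee'.
Qed.

Lemma small1 x xs S e : x \in xs -> small xs S e -> small [:: x] S e.
Proof.
move=> xxs [C [Cm SC Ce]]; exists C; split=> // n.
exact: le_trans (mass1_le _ xxs) (Ce n).
Qed.

Lemma small0 xs : small xs set0 0.
Proof.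
exists (fun=> CFalse); split; [by move=> n p | by move=> p [] |].
by move=> n; rewrite mass_False.
Qed.

(** By compactness a clopen set has no outer mass below its own mass; this makes the limits of
    clopen approximants well defined. *)
Lemma small_clopen xs c e : small xs [set p | cmem c p] e -> mass xs c <= e.
Proof.
move=> [C [Cm cC Ce]]; have [n cn] := clopen_compact Cm cC.
exact: le_trans (mass_mono xs cn) (Ce n).
Qed.

Lemma small_bigcup xs (S : nat -> set (nat -> bool)) (e : nat -> R) a :
  (forall n, small xs (S n) (e n)) -> (forall n, \sum_(k < n) e k <= a) ->
  small xs (\bigcup_n S n) a.
Proof.
move=> /choice[C hC] ea.
have Cmono k m n : (m <= n)%N -> csub (C k m) (C k n).
  by apply: csub_homo => i; have [Ck _ _] := hC k; exact: Ck.
(* A diagonal union: stage n uses the first n covers, each at its own stage n. *)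
exists (fun n => COrs (fun k => C k n) n); split.
- move=> n p /cmem_Ors[k kn pk]; apply/cmem_Ors; exists k; first exact: ltnW.
  exact: Cmono pk.
- move=> p [k _ pk]; have [_ /(_ p pk)[n pn] _] := hC k.
  exists (maxn n k.+1); apply/cmem_Ors; exists k; first exact: leq_maxr.
  by apply: Cmono pn; exact: leq_maxl.
- move=> n; apply: le_trans (mass_Ors _ _ _) _; apply: le_trans (ea n).
  by apply: ler_sum => k _; have [_ _] := hC k.
Qed.

Lemma smallU xs S T a b : small xs S a -> small xs T b -> small xs (S `|` T) (a + b).
Proof.
move=> [C [Cm SC Ce]] [D [Dm TD De]]; exists (fun n => COr (C n) (D n)); split.
- by move=> n p; rewrite !cmem_Or => /orP[/Cm ->|/Dm ->]; rewrite ?orbT.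
- move=> p [/SC|/TD] [n pn]; exists n; by rewrite cmem_Or pn ?orbT.
- by move=> n; apply: le_trans (mass_Or _ _ _) _; exact: lerD.
Qed.

End CommutingProjections.

(** * The projection-valued measure on the Cantor space *)

Section CantorSpectralMeasure.
Context {R : realType} {H : hilbertSpace R}.
Implicit Types (x y z : H) (xs : seq H) (S T : set (nat -> bool)) (e : R).
Variable r : nat -> H -> H.
Hypothesis r_proj : forall n, proj_op (r n).
Hypothesis r_comm : forall m n, commutes (r m) (r n).

Local Notation Q := (cproj r).
Local Notation small := (small r).
Let Q_lin := cproj_linear r_proj.
Let Q_contr := cproj_contr r_proj r_comm.

Definition csdiff S c : set (nat -> bool) := [set p | ~ (S p <-> cmem c p)].

Definition cmeasurable S :=
  forall xs e, 0 < e -> exists c, small xs (csdiff S c) e.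

Lemma csdiff_setC S c : csdiff (~` S) (CNeg c) = csdiff S c.
Proof.
apply/seteqP; split=> p /= h k; apply: h.
  by split=> [nS|/negP nc /k//]; apply/negP => /k.
split=> [Sp|cp]; apply: contrapT; first by move/negP/k.
by move/k/negP; apply.
Qed.

Lemma csdiff_setI S T c d :
  csdiff (S `&` T) (CAnd c d) `<=` csdiff S c `|` csdiff T d.
Proof.
move=> p /= h; apply: contrapT => /not_orP[/contrapT k1 /contrapT k2]; apply: h.
by split=> [[/k1 cp /k2 dp]|/andP[/k1 ? /k2 ?]] //; apply/andP.
Qed.

Lemma cmeasurableC S : cmeasurable S -> cmeasurable (~` S).
Proof.
by move=> mS xs e e0; have [c hc] := mS xs e e0; exists (CNeg c); rewrite csdiff_setC.
Qed.

Lemma cmeasurableI S T : cmeasurable S -> cmeasurable T -> cmeasurable (S `&` T).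
Proof.
move=> mS mT xs e e0; have e2 : 0 < e / 2 by lra.
have [c hc] := mS xs _ e2; have [d hd] := mT xs _ e2.
exists (CAnd c d); apply: small_le (smallU r_proj r_comm hc hd) (@csdiff_setI _ _ _ _) _.
by lra.
Qed.

Lemma cmeasurableU S T : cmeasurable S -> cmeasurable T -> cmeasurable (S `|` T).
Proof.
move=> mS mT; rewrite -[S `|` T]setCK setCU; apply: cmeasurableC.
by apply: cmeasurableI; exact: cmeasurableC.
Qed.

Lemma cmeasurableD S T : cmeasurable S -> cmeasurable T -> cmeasurable (S `\` T).
Proof. by move=> mS mT; rewrite setDE; apply: cmeasurableI => //; exact: cmeasurableC. Qed.

Lemma small_csdiff_clopen xs c : small xs (csdiff [set p | cmem c p] c) 0.
Proof. by apply: small_le (small0 r_proj r_comm xs) _ _ => // p /= h; apply: h. Qed.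

Lemma cmeasurable_clopen c : cmeasurable [set p | cmem c p].
Proof.
by move=> xs e e0; exists c; apply: small_le (small_csdiff_clopen xs c) _ (ltW e0).
Qed.

Lemma cproj_csdiff x xs S c d e e' : x \in xs ->
  small xs (csdiff S c) e -> small xs (csdiff S d) e' ->
  nsq (Q c x - Q d x) <= 4 * (e + e').
Proof.
move=> xxs sc sd.
have scd := smallU r_proj r_comm (small1 xxs sc) (small1 xxs sd).
have h c' d' : (forall p, cmem c' p -> ~~ cmem d' p -> (csdiff S c `|` csdiff S d) p) ->
    nsq (Q (CDiff c' d') x) <= e + e'.
  move=> sub; have := small_clopen r_proj r_comm (c := CDiff c' d') (xs := [:: x]) (e := e + e').
  rewrite /mass big_seq1; apply; apply: small_le scd _ _ => // p /=.
  by move=> /andP[dp cp]; exact: sub.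
have h1 := h c d; have h2 := h d c.
have -> : Q c x - Q d x = Q (CDiff c d) x - Q (CDiff d c) x.
  rewrite /= (cprojC r_proj r_comm d c).
  by apply: ip_ext => t; rewrite !ipE; lra.
apply: le_trans (nsqD2 _ _) _; rewrite nsqN.
have {}h1 : nsq (Q (CDiff c d) x) <= e + e'.
  apply: h1 => p cp dp; apply: contrapT => /not_orP[/contrapT k1 /contrapT k2].
  by move: cp => /k1/k2; exact/negP.
have {}h2 : nsq (Q (CDiff d c) x) <= e + e'.
  apply: h2 => p cp dp; apply: contrapT => /not_orP[/contrapT k1 /contrapT k2].
  by move: cp => /k2/k1; exact/negP.
lra.
Qed.

Lemma nsq_small_eq0 x (C : R) : 0 <= C -> (forall e, 0 < e -> nsq x <= C * e) -> x = 0.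
Proof.
move=> C0 h; apply/nsq_eq0/eqP; rewrite eq_le nsq_ge0 andbT.
apply/ler_addgt0Pr => e e0; rewrite add0r.
have C1 : 0 < C + 1 by lra.
apply: le_trans (h (e / (C + 1)) (divr_gt0 e0 C1)) _.
rewrite mulrCA ler_piMr ?(ltW e0)// ler_pdivrMr//; lra.
Qed.

(** The limit at x uses approximants good at x alone, but the estimate covers every approximant good
    on a list containing x. The constant 8 is 2 from [nsqD2] times 4 from [cproj_csdiff]. *)
Lemma exists_cmeasure S : cmeasurable S -> exists T : H -> H,
  forall x xs c e, x \in xs -> small xs (csdiff S c) e ->
    nsq (T x - Q c x) <= 8 * e.
Proof.
move=> mS.
have inv_gt0 n : (0 : R) < n.+1%:R^-1 by rewrite invr_gt0.
have /choice[f hf] (nx : nat * H) := mS [:: nx.2] _ (inv_gt0 nx.1).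
have xx x : x \in [:: x] by rewrite mem_head.
have cf x : cauchys (fun n => Q (f (n, x)) x).
  move=> e e0; have [|N hN] := @inv_nat_small R (e / 8); first by lra.
  exists N => m n Nm Nn.
  have := cproj_csdiff (xx x) (hf (m, x)) (hf (n, x)).
  have := hN m Nm; have := hN n Nn => /=.
  move: (m.+1%:R^-1) (n.+1%:R^-1) => a b; lra.
have [T hT] := op_limit cf.
exists T => x xs c e xxs sc; apply/ler_addgt0Pr => d d0.
have [|N1 h1] := hT x (d / 4); first by lra.
have [|N2 h2] := @inv_nat_small R (d / 16); first by lra.
have := h1 _ (leq_maxl N1 N2); have := h2 _ (leq_maxr N1 N2).
set n := maxn _ _ => h3 h4.
have := cproj_csdiff (xx x) (hf (n, x)) (small1 xxs sc).
have := nsqB2 (T x) (Q (f (n, x)) x) (Q c x); rewrite (nsqBC (T x) (Q (f _) x)) /=.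
move: h3 h4; rewrite /=; move: (n.+1%:R^-1) => a; lra.
Qed.

Definition cmeasure S : H -> H :=
  match pselect (cmeasurable S) with
  | left mS => projT1 (cid (exists_cmeasure mS))
  | right _ => fun=> 0
  end.

Local Notation E := cmeasure.

Lemma cmeasure_approx S x xs c e : cmeasurable S -> x \in xs ->
  small xs (csdiff S c) e -> nsq (E S x - Q c x) <= 8 * e.
Proof. by move=> mS; rewrite /E; case: pselect => // mS'; case: cid => T /=; apply. Qed.

Lemma cmeasure_clopen c x : E [set p | cmem c p] x = Q c x.
Proof.
apply/eqP; rewrite -subr_eq0; apply/eqP/nsq_eq0/eqP; rewrite eq_le nsq_ge0 andbT.
rewrite -[leRHS](mulr0 8); apply: cmeasure_approx (mem_head x [::]) _.
  exact: cmeasurable_clopen.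
exact: small_csdiff_clopen.
Qed.

(** The law holds exactly for the projection of a clopen set; one such set, approximating at x, y
    and a x + y together, transfers it up to a multiple of e. The other laws of the measure are
    transferred in the same way. *)
Lemma cmeasure_linear S : cmeasurable S -> linear (E S).
Proof.
move=> mS a x y; apply/eqP; rewrite -subr_eq0; apply/eqP.
pose q := complex.Re a ^+ 2 + complex.Im a ^+ 2.
have q0 : 0 <= q by rewrite addr_ge0 ?sqr_ge0.
apply: (@nsq_small_eq0 _ (32 * q + 48)) => [|e e0]; first by lra.
have [c hc] := mS [:: a *: x + y; x; y] e e0.
have h1 := cmeasure_approx mS (mem_head _ _) hc.
have h2 : nsq (E S x - Q c x) <= 8 * e by apply: cmeasure_approx hc => //; rewrite !inE eqxx orbT.
have h3 : nsq (E S y - Q c y) <= 8 * e by apply: cmeasure_approx hc => //; rewrite !inE eqxx !orbT.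
have -> : E S (a *: x + y) - (a *: E S x + E S y) =
    (E S (a *: x + y) - Q c (a *: x + y)) -
    (a *: (E S x - Q c x) + (E S y - Q c y)).
  rewrite Q_lin scalerBr.
  by apply: ip_ext => t; rewrite !ipE; lra.
apply: le_trans (nsqD2 _ _) _; rewrite nsqN.
have := nsqD2 (a *: (E S x - Q c x)) (E S y - Q c y); rewrite nsqZc -/q.
have : q * nsq (E S x - Q c x) <= q * (8 * e) by exact: ler_wpM2l.
lra.
Qed.

Lemma cmeasure_sym S : cmeasurable S -> sym_op (E S).
Proof.
move=> mS x y; apply/eqP; rewrite -subr_eq0 -sqrf_eq0 eq_le sqr_ge0 andbT.
apply/ler_addgt0Pr => e e0; rewrite add0r.
have xy0 : 0 < nsq x + nsq y + 1 by have := nsq_ge0 x; have := nsq_ge0 y; lra.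
pose e' := e / (16 * (nsq x + nsq y + 1)).
have e'0 : 0 < e' by apply: divr_gt0 => //; lra.
have ee' : 16 * (e' * (nsq x + nsq y + 1)) = e by rewrite /e'; field; rewrite gt_eqF.
have [c hc] := mS [:: x; y] _ e'0.
have h1 := cmeasure_approx mS (mem_head _ _) hc.
have h2 : nsq (E S y - Q c y) <= 8 * e' by apply: cmeasure_approx hc => //; rewrite !inE eqxx orbT.
have -> : ip (E S x) y - ip x (E S y) = ip (E S x - Q c x) y - ip (E S y - Q c y) x.
  have [_ sQ _] := cproj_proj r_proj r_comm c.
  by rewrite !ipE sQ (ipC x (E S y)) (ipC x (Q c y)); lra.
have := ip_CauchySchwarz (E S x - Q c x) y.
have := ip_CauchySchwarz (E S y - Q c y) x.
set u := ip _ y; set v := ip _ x => hv hu.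
have := sqr_ge0 (u + v).
have : nsq (E S x - Q c x) * nsq y <= 8 * e' * nsq y by rewrite ler_wpM2r ?nsq_ge0.
have : nsq (E S y - Q c y) * nsq x <= 8 * e' * nsq x by rewrite ler_wpM2r ?nsq_ge0.
lra.
Qed.

(** The approximation of S has to be good at the vector E T x, to which E S is applied, as well as
    at x; the list contains both. *)
Lemma cmeasureI S T x : cmeasurable S -> cmeasurable T ->
  E (S `&` T) x = E S (E T x).
Proof.
move=> mS mT; apply/eqP; rewrite -subr_eq0; apply/eqP.
apply: (@nsq_small_eq0 _ 96) => // e e0.
have [c hc] := mS [:: x; E T x] e e0; have [d hd] := mT [:: x; E T x] e e0.
have h1 : nsq (E (S `&` T) x - Q c (Q d x)) <= 8 * (e + e).
  apply: (@cmeasure_approx _ _ [:: x; E T x] (CAnd c d)).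
  - exact: cmeasurableI.
  - exact: mem_head.
  - exact: small_le (smallU r_proj r_comm hc hd) (@csdiff_setI _ _ _ _) (lexx _).
have h2 := cmeasure_approx mT (mem_head _ _) hd.
have h3 : nsq (E S (E T x) - Q c (E T x)) <= 8 * e.
  by apply: cmeasure_approx hc => //; rewrite !inE eqxx orbT.
have h4 := Q_contr c (E T x - Q d x); rewrite (lin_B (Q_lin c)) in h4.
apply: le_trans (nsqB2 _ (Q c (Q d x)) _) _.
have := nsqB2 (Q c (Q d x)) (Q c (E T x)) (E S (E T x)).
rewrite (nsqBC (Q c (Q d x)) (Q c _)) (nsqBC (Q c (E T x)) (E S _)); lra.
Qed.

Lemma cmeasureC S x : cmeasurable S -> E (~` S) x = x - E S x.
Proof.
move=> mS; apply/eqP; rewrite -subr_eq0; apply/eqP.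
apply: (@nsq_small_eq0 _ 32) => // e e0.
have [c hc] := mS [:: x] e e0.
have h1 := cmeasure_approx mS (mem_head _ _) hc.
have h2 : nsq (E (~` S) x - (x - Q c x)) <= 8 * e.
  apply: (@cmeasure_approx _ _ [:: x] (CNeg c)); first exact: cmeasurableC.
    exact: mem_head.
  by rewrite csdiff_setC.
have := nsqB2 (E (~` S) x) (x - Q c x) (x - E S x).
have -> : x - Q c x - (x - E S x) = E S x - Q c x.
  by apply: ip_ext => t; rewrite !ipE; lra.
lra.
Qed.

Lemma cmeasure_proj S : cmeasurable S -> proj_op (E S).
Proof.
move=> mS; split; [exact: cmeasure_linear | exact: cmeasure_sym |].
by move=> x; rewrite -cmeasureI// setIid.
Qed.

Lemma cmeasure_small S x e : cmeasurable S -> small [:: x] S e -> nsq (E S x) <= 8 * e.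
Proof.
move=> mS sS; have -> : E S x = E S x - Q CFalse x.
  by rewrite (cproj_empty r_proj r_comm) ?subr0// => p; rewrite cmem_False.
apply: cmeasure_approx (mem_head _ _) _ => //.
apply: small_le sS _ (lexx _) => p; rewrite /csdiff /= andbN => h.
by apply: contrapT => nS; apply: h.
Qed.

Lemma set0_cmem : set0 = [set p | cmem CFalse p].
Proof. by apply/seteqP; split=> p //=; rewrite andbN. Qed.

Lemma cmeasurable0 : cmeasurable set0.
Proof. by rewrite set0_cmem; exact: cmeasurable_clopen. Qed.

Lemma cmeasure0 x : E set0 x = 0.
Proof.
rewrite set0_cmem cmeasure_clopen (cproj_empty r_proj r_comm)// => p.
by rewrite cmem_False.
Qed.

Lemma cmeasureU S T x : cmeasurable S -> cmeasurable T -> S `&` T = set0 ->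
  E (S `|` T) x = E S x + E T x.
Proof.
move=> mS mT ST0; have mCS := cmeasurableC mS; have mCT := cmeasurableC mT.
rewrite -[S `|` T]setCK setCU cmeasureC; last exact: cmeasurableI.
rewrite cmeasureI// !cmeasureC// (lin_B (cmeasure_linear mS)) -cmeasureI// ST0 cmeasure0.
by apply: ip_ext => t; rewrite !ipE; lra.
Qed.

(* The approximants of S_n combine into an open set whose mass, being bounded
   by the squared norms of xs, is exhausted by finitely many of them. *)
Lemma bigcup_csdiff (S : nat -> set (nat -> bool)) xs e : 0 < e ->
  (forall n, cmeasurable (S n)) ->
  exists N, forall n, (N <= n)%N -> exists c,
    small xs (csdiff (\bigcup_k S k) c) e /\
    small xs (csdiff (\bigcup_(k < n) S k) c) e.
Proof.
move=> e0 mS; have e2 : 0 < e / 2 by lra.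
have g0 n : 0 < e / 2 * 2^-1 ^+ n.+1 by rewrite mulr_gt0// exprn_gt0// invr_gt0.
have /choice[C hC] n := mS n xs _ (g0 n).
have gsum n : \sum_(k < n) (e / 2 * 2^-1 ^+ k.+1) <= e / 2.
  suff -> : \sum_(k < n) (e / 2 * 2^-1 ^+ k.+1) = e / 2 * (1 - 2^-1 ^+ n).
    by rewrite ler_piMr ?(ltW e2)// gerBl exprn_ge0.
  elim: n => [|n IH]; first by rewrite big_ord0 expr0 subrr mulr0.
  by rewrite big_ord_recr /= IH !exprS; field.
have sU := small_bigcup r_proj r_comm hC gsum.
have Umono n : csub (COrs C n) (COrs C n.+1).
  by move=> p; rewrite [COrs C n.+1]/= cmem_Or => ->.
have [||N hN] := @monotone_bounded_cauchy _ (fun n => mass r xs (COrs C n)) (\sum_(x <- xs) nsq x) _ _ _ e2.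
- by move=> n; exact: mass_mono.
- by move=> n; apply: ler_sum => x _; exact: Q_contr.
exists N => n Nn; exists (COrs C n); split.
(* The points in some C k but outside the n-th union are exhausted by the differences of later
   unions with it, whose masses are increments of a bounded monotone sequence. *)
- have tail : small xs [set p | (exists k, cmem (C k) p) /\ ~~ cmem (COrs C n) p] (e / 2).
    exists (fun m => CDiff (COrs C (m + n)%N) (COrs C n)); split.
    + by move=> m p; rewrite !cmem_Diff addSn => /andP[/Umono -> ->].
    + move=> p [[k pk] np]; exists k.+1; rewrite cmem_Diff np andbT.
      by apply/cmem_Ors; exists k => //; rewrite addSn ltnS leq_addr.
    + move=> m; have := mass_Diff r_proj r_comm xs (csub_homo Umono (leq_addl m n)).
      have := hN (m + n)%N n; rewrite (leq_trans Nn) ?leq_addl// Nn => /(_ isT isT).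
      by rewrite ler_norml; lra.
  apply: small_le (smallU r_proj r_comm sU tail) _ _; last by lra.
  move=> p /= h; apply: contrapT => /not_orP[h1 h2]; apply: h; split.
  + move=> [k _ Skp]; apply: contrapT => /negP np; apply: h2; split=> //.
    exists k; apply: contrapT => nk; apply: h1; exists k => // -[h _].
    exact/nk/h.
  + move/cmem_Ors => [k kn pk]; exists k => //; apply: contrapT => nS.
    by apply: h1; exists k => // -[_ h]; exact/nS/h.
- apply: small_le sU _ _; last by lra.
  move=> p /= h; apply: contrapT => h1; apply: h; split.
  + move=> [k /= kn Skp]; apply/cmem_Ors; exists k => //.
    apply: contrapT => nk; apply: h1; exists k => // -[h _]; exact/nk/h.
  + move/cmem_Ors => [k kn pk]; exists k => //; apply: contrapT => nS.
    by apply: h1; exists k => // -[_ h]; exact/nS/h.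
Qed.

Lemma cmeasurable_bigcup (S : nat -> set (nat -> bool)) :
  (forall n, cmeasurable (S n)) -> cmeasurable (\bigcup_n S n).
Proof.
move=> mS xs e e0; have [N /(_ N (leqnn N))[c [hc _]]] := bigcup_csdiff xs e0 mS.
by exists c.
Qed.

Lemma cmeasurable_bigcup_lt (S : nat -> set (nat -> bool)) n :
  (forall n, cmeasurable (S n)) -> cmeasurable (\bigcup_(k < n) S k).
Proof.
move=> mS; rewrite bigcup_mkcond; apply: cmeasurable_bigcup => k.
by case: ifP => // _; exact: cmeasurable0.
Qed.

Lemma cmeasure_bigcup (S : nat -> set (nat -> bool)) x :
  (forall n, cmeasurable (S n)) -> trivIset setT S ->
  lims (fun n => \sum_(k < n) E (S k) x) (E (\bigcup_n S n) x).
Proof.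
move=> mS tS.
have fin n : \sum_(k < n) E (S k) x = E (\bigcup_(k < n) S k) x.
  elim: n => [|n IH]; first by rewrite big_ord0 bigcup_mkord big_ord0 cmeasure0.
  rewrite big_ord_recr /= IH -cmeasureU//; last 2 first.
  - exact: cmeasurable_bigcup_lt.
  - apply/seteqP; split=> // p [[k /= kn Sk] Sn].
    by have := tS k n I I (ex_intro _ p (conj Sk Sn)) => kn'; rewrite kn' ltnn in kn.
  by rewrite !bigcup_mkord big_ord_recr.
(* One clopen set approximates the finite and the infinite union; the two errors 8 (e / 32), doubled
   by [nsqB2], add up to e. *)
move=> e e0; have e1 : 0 < e / 32 by lra.
have [N hN] := bigcup_csdiff [:: x] e1 mS.
exists N => n Nn; have [c [h1 h2]] := hN n Nn; rewrite fin.
have k1 := cmeasure_approx (cmeasurable_bigcup mS) (mem_head _ _) h1.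
have k2 := cmeasure_approx (cmeasurable_bigcup_lt n mS) (mem_head _ _) h2.
apply: le_trans (nsqB2 _ (Q c x) _) _.
rewrite (nsqBC (Q c x)); lra.
Qed.

(** The clopen sets where one of the first n bits is true have mass 0 at y and exhaust the
    complement of the zero sequence. *)
Lemma cmeasure_kernel S y : (forall n, r n y = 0) -> ~ S (fun=> false) ->
  cmeasurable S -> E S y = 0.
Proof.
move=> ry nS mS; apply: (@nsq_small_eq0 _ 8) => // e e0.
apply: cmeasure_small => //.
exists (COrs CBit); split.
- by move=> n p; rewrite [COrs _ n.+1]/= cmem_Or => ->.
- move=> p Sp; have [n pn] : exists n, p n.
    apply: contrapT => np; apply: nS; rewrite (_ : (fun=> false) = p)//.
    by apply/funext => n; apply/esym/negbTE/negP => pn; apply: np; exists n.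
  by exists n.+1; apply/cmem_Ors; exists n.
- move=> n; rewrite /mass big_seq1 (cproj_eigen r_proj (p := fun=> false)).
    case: ifP => [/cmem_Ors[]//|_]; rewrite /nsq ip0l; exact: ltW.
  by move=> k _; exact: ry.
Qed.

End CantorSpectralMeasure.

(** * Integrals of simple functions *)

Section ComplexSquares.
Context {R : realType}.
Implicit Types (c d w : Cx R) (e : R).

Definition csq c : R := complex.Re c ^+ 2 + complex.Im c ^+ 2.

Lemma csq_ge0 c : 0 <= csq c.
Proof. by rewrite addr_ge0 ?sqr_ge0. Qed.

Lemma csq0 : csq 0 = 0.
Proof. by rewrite /csq /= expr0n addr0. Qed.

Lemma csqM c d : csq (c * d) = csq c * csq d.
Proof. by case: c d => [a b] [a' b']; rewrite /csq /=; ring. Qed.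

Lemma csqD2 c d : csq (c + d) <= 2 * csq c + 2 * csq d.
Proof.
case: c d => [a b] [a' b']; rewrite /csq /=.
have := sqr_ge0 (a - a'); have := sqr_ge0 (b - b'); lra.
Qed.

Lemma csqN c : csq (- c) = csq c.
Proof. by case: c => [a b]; rewrite /csq /= !sqrrN. Qed.

Lemma csqBC c d : csq (c - d) = csq (d - c).
Proof. by rewrite -csqN opprB. Qed.

Lemma csqB2 c d w : csq (c - w) <= 2 * csq (c - d) + 2 * csq (d - w).
Proof.
have -> : c - w = (c - d) + (d - w) by rewrite addrA subrK.
exact: csqD2.
Qed.

Lemma csq_norm c : (csq c)%:C%C = `|c| ^+ 2.
Proof. exact: add_Re2_Im2. Qed.

Lemma csq_le c e : 0 <= e -> (csq c <= e ^+ 2) = (`|c| <= e%:C%C).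
Proof.
move=> e0; rewrite -(@ler_sqr (Cx R)) ?nnegrE ?normr_ge0 ?ler0c//.
by rewrite -[X in _ = (X <= _)]csq_norm -rmorphXn lecR.
Qed.

Lemma csq_lt c e : 0 <= e -> (csq c < e ^+ 2) = (`|c| < e%:C%C).
Proof.
move=> e0; rewrite -(@ltr_sqr (Cx R)) ?nnegrE ?normr_ge0 ?ler0c//.
by rewrite -[X in _ = (X < _)]csq_norm -rmorphXn ltcR.
Qed.

Lemma csq_net (K e : R) : 0 < e -> exists cs : seq (Cx R),
  forall w, csq w <= K -> exists2 c, c \in cs & csq (w - c) < e.
Proof.
move=> e0; have [K0|K0] := ltP K 0.
  by exists [::] => w wK; have := csq_ge0 w; lra.
(* With mesh d the two coordinates contribute at most 2e / 3, which is strictly below e. *)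
pose d := Num.sqrt (e / 3).
have d0 : 0 < d by rewrite sqrtr_gt0; lra.
have d2 : d ^+ 2 = e / 3 by rewrite sqr_sqrtr//; lra.
(* t^2 <= K gives |t| <= K + 1, by (t - 1)^2 >= 0 and (t + 1)^2 >= 0. *)
pose L := K + 1.
pose pts := [seq - L + j%:R * d | j <- iota 0 (Num.trunc (2 * L / d)).+1].
have net (t : R) : t ^+ 2 <= K -> exists2 a, a \in pts & (t - a) ^+ 2 <= d ^+ 2.
  move=> tK; have tL : - L <= t <= L.
    rewrite /L; have := sqr_ge0 (t - 1); have := sqr_ge0 (t + 1); lra.
  have q0 : 0 <= (t + L) / d by rewrite divr_ge0 ?(ltW d0)//; lra.
  have /andP[j1 j2] := truncn_itv q0.
  exists (- L + (Num.trunc ((t + L) / d))%:R * d).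
    apply/mapP; exists (Num.trunc ((t + L) / d)) => //.
    rewrite mem_iota add0n ltnS; apply: le_truncn.
    by rewrite ler_pM2r ?invr_gt0//; lra.
  rewrite ler_pdivlMr// in j1; rewrite ltr_pdivrMr// in j2.
  rewrite -natr1 mulrDl mul1r in j2.
  by rewrite -ler_sqrt ?sqr_ge0// sqrtr_sqr sqrtr_sqr (ger0_norm (ltW d0)) ler_norml; lra.
clearbody pts.
exists [seq (a +i* b)%C | a <- pts, b <- pts] => -[a b]; rewrite {1}/csq /= => abK.
have [|a' a's aa'] := net a; first by have := sqr_ge0 b; lra.
have [|b' b's bb'] := net b; first by have := sqr_ge0 a; lra.
exists (a' +i* b')%C; first exact: allpairs_f.
rewrite /csq /=; lra.
Qed.

End ComplexSquares.

(** * Uniform limits of simple functions over a finitely additive projection-valued measure *)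

Section SimpleIntegrals.
Context {R : realType} {H : hilbertSpace R}.
Implicit Types (x y z : H) (c : Cx R) (e K : R).
Variables (Y : Type) (W : set Y) (M : set (set Y)) (E : set Y -> H -> H).

(** Kept abstract because it is instantiated twice, on the Cantor space and on the quadrant. Finite
    additivity appears as [pc_split]. *)
Record projection_content : Prop := {
  pc_sub : forall A, M A -> A `<=` W;
  pc_unit : M W;
  pc_setI : forall A B, M A -> M B -> M (A `&` B);
  pc_setD : forall A B, M A -> M B -> M (A `\` B);
  pc_proj : forall A, M A -> proj_op (E A);
  pc_empty : forall x, E set0 x = 0;
  pc_mul : forall A B x, M A -> M B -> E (A `&` B) x = E A (E B x);
  pc_split : forall A B x, M A -> M B -> E A x = E (A `&` B) x + E (A `\` B) x
}.

Hypothesis pcE : projection_content.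

Local Notation simple := (seq (Cx R * set Y)).
Implicit Types (s : simple) (A B : set Y) (g : Y -> Cx R) (T : H -> H).

Definition sfun s (t : Y) : Cx R := \sum_(cA <- s) cA.1 * \1_(cA.2) t.
Definition sint s x : H := \sum_(cA <- s) cA.1 *: E cA.2 x.
Definition smeas s := forall c A, (c, A) \in s -> M A.
Definition sneg s : simple := [seq (- cA.1, cA.2) | cA <- s].
Definition smul s s' : simple :=
  [seq (a.1 * b.1, a.2 `&` b.2) | a <- s, b <- s'].

Lemma smeas_cons c A s : smeas ((c, A) :: s) <-> M A /\ smeas s.
Proof.
split=> [h|[mA ms] c' A']; last by rewrite inE => /orP[/eqP[_ ->]|/ms].
split=> [|c' A' cA]; first by apply: (h c); rewrite mem_head.
by apply: (h c'); rewrite inE cA orbT.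
Qed.

Lemma smeas_cat s s' : smeas s -> smeas s' -> smeas (s ++ s').
Proof. by move=> ms ms' c A; rewrite mem_cat => /orP[/ms|/ms']. Qed.

Lemma smeas_neg s : smeas s -> smeas (sneg s).
Proof. by move=> ms c A /mapP[[c' A'] /= /ms mA' [_ ->]]. Qed.

Lemma smeas_mul s s' : smeas s -> smeas s' -> smeas (smul s s').
Proof.
move=> ms ms' c A /allpairsP[[[a A1] [b B1]] /= [/ms mA /ms' mB [_ ->]]].
exact: pc_setI.
Qed.

Lemma sfun_cat s s' t : sfun (s ++ s') t = sfun s t + sfun s' t.
Proof. exact: big_cat. Qed.

Lemma sint_cat s s' x : sint (s ++ s') x = sint s x + sint s' x.
Proof. exact: big_cat. Qed.

Lemma sfun_neg s t : sfun (sneg s) t = - sfun s t.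
Proof. by rewrite /sfun big_map -sumrN; apply: eq_bigr => cA _; rewrite mulNr. Qed.

Lemma sint_neg s x : sint (sneg s) x = - sint s x.
Proof. by rewrite /sint big_map -sumrN; apply: eq_bigr => cA _; rewrite scaleNr. Qed.

Lemma sfun_mul s s' t : sfun (smul s s') t = sfun s t * sfun s' t.
Proof.
rewrite /sfun big_allpairs_dep mulr_suml; apply: eq_bigr => a _.
by rewrite mulr_sumr; apply: eq_bigr => b _ /=; rewrite indicI /= mulrACA.
Qed.

Lemma content_linear A : M A -> linear (E A).
Proof. by case/(pc_proj pcE). Qed.

Lemma sint_cont s : smeas s -> cont_op (sint s).
Proof.
elim: s => [|[c A] s IH].
  move=> _; have := @cont_op0 R H; congr cont_op.
  by apply/funext => x; rewrite /sint big_nil.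
move=> /smeas_cons[mA /IH cs]; have := contD (contZc c (proj_cont (pc_proj pcE mA))) cs.
by congr cont_op; apply/funext => x; rewrite /sint big_cons.
Qed.

Lemma sint_linear s : smeas s -> linear (sint s).
Proof. by case/sint_cont. Qed.

Lemma contentC A B x : M A -> M B -> E A (E B x) = E B (E A x).
Proof. by move=> mA mB; rewrite -!(pc_mul pcE)// setIC. Qed.

Lemma sint_commutes s B x : M B -> smeas s -> E B (sint s x) = sint s (E B x).
Proof.
move=> mB; have lB := content_linear mB.
elim: s => [_|[c A] s IH /smeas_cons[mA ms]]; first by rewrite /sint !big_nil (lin_0 lB).
by rewrite /sint !big_cons lB -/(sint s x) IH//= contentC.
Qed.

Lemma sint_mul s s' x : smeas s -> smeas s' -> sint (smul s s') x = sint s (sint s' x).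
Proof.
move=> ms ms'; rewrite /sint big_allpairs_dep.
rewrite [LHS]big_seq [RHS]big_seq; apply: eq_bigr => -[c A] /ms mA /=.
rewrite -/(sint s' x) sint_commutes// /sint scaler_sumr.
rewrite [LHS]big_seq [RHS]big_seq; apply: eq_bigr => -[d B] /ms' mB /=.
by rewrite scalerA (pc_mul pcE)// contentC.
Qed.

Lemma content_orth A B x y : M A -> M B -> A `&` B = set0 ->
  ip (E A x) (E B y) = 0.
Proof.
move=> mA mB AB; have [_ sA _] := pc_proj pcE mA.
by rewrite sA -(pc_mul pcE)// AB (pc_empty pcE) ip0r.
Qed.

(** This serves the positivity of the filter: its approximants have values of the symbol as
    coefficients. *)
Lemma sint_sym_pos s : smeas s ->
  (forall c A, (c, A) \in s -> exists2 a : R, 0 <= a & c = a%:C%C) ->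
  sym_op (sint s) /\ pos_op (sint s).
Proof.
elim: s => [|[c A] s IH].
  by move=> _ _; split=> [x y|x]; rewrite /sint !big_nil !ipE.
move=> /smeas_cons[mA ms] hc.
have [a a0 ->] : exists2 a : R, 0 <= a & c = a%:C%C.
  by apply: (hc c A); rewrite mem_head.
have [|ys ps] := IH ms.
  by move=> c' A' h; apply: (hc c' A'); rewrite inE h orbT.
have pA := pc_proj pcE mA; have [_ sA _] := pA.
split=> [x y|x]; rewrite /sint !big_cons /= -/(sint s x) scalec_real !ipE.
  by rewrite -/(sint s y) sA ys.
by rewrite addr_ge0// mulr_ge0// -(proj_nsq _ pA) nsq_ge0.
Qed.

(* Splitting B along the first set of s decouples the sum orthogonally. *)
Lemma sint_bound_on s B c K x : smeas s -> M B ->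
  (forall t, B t -> csq (c + sfun s t) <= K) ->
  nsq (c *: E B x + sint s (E B x)) <= K * nsq (E B x).
Proof.
elim: s B c => [|[d A] s IH] B c ms mB bnd.
  rewrite /sint big_nil addr0 nsqZc -/(csq c).
  have [[t Bt]|B0] := pselect (exists t, B t).
    by have := bnd t Bt; rewrite /sfun big_nil addr0 => h; rewrite ler_wpM2r ?nsq_ge0.
  have -> : B = set0 by apply/seteqP; split=> // t Bt; apply: B0; exists t.
  by rewrite (pc_empty pcE) /nsq ip0l !mulr0.
have /smeas_cons[mA {}ms] := ms.
have mB1 := pc_setI pcE mB mA; have mB2 := pc_setD pcE mB mA.
set B1 := B `&` A in mB1; set B2 := B `\` A in mB2.
have disj : B1 `&` B2 = set0 by apply/seteqP; split=> t // -[[_ At] [_ nAt]].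
have EB : E B x = E B1 x + E B2 x := pc_split pcE x mB mA.
have ls := sint_linear ms.
(* [c] accumulates the coefficients of the listed sets already known to contain the current set: [d]
   joins it on B1 and is dropped on B2. *)
pose v1 := (c + d) *: E B1 x + sint s (E B1 x).
pose v2 := c *: E B2 x + sint s (E B2 x).
have idem A' : M A' -> E A' (E A' x) = E A' x by move=> mA'; case: (pc_proj pcE mA').
have v1E : E B1 v1 = v1.
  by rewrite /v1 (content_linear mB1) sint_commutes// idem.
have v2E : E B2 v2 = v2.
  by rewrite /v2 (content_linear mB2) sint_commutes// idem.
have -> : c *: E B x + sint ((d, A) :: s) (E B x) = v1 + v2.
  rewrite /sint big_cons -/(sint s _) /= contentC// -(pc_mul pcE)// -/B1 {2}EB.
  rewrite EB (lin_D ls) /v1 /v2 scalerDl scalerDr.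
  by apply: ip_ext => t; rewrite !ipE; lra.
have orth u v : nsq (E B1 u + E B2 v) = nsq (E B1 u) + nsq (E B2 v).
  by rewrite /nsq !ipE (ipC (E B2 v)) (content_orth u v mB1 mB2 disj); lra.
rewrite -v1E -v2E orth v1E v2E EB orth mulrDr; apply: lerD; apply: IH => //.
- move=> t [Bt At]; have := bnd t Bt.
  by rewrite /sfun big_cons /= indicE mem_set// mulr1 addrA.
- move=> t [Bt nAt]; have := bnd t Bt.
  by rewrite /sfun big_cons /= indicE memNset// mulr0 add0r.
Qed.

Lemma content_unit A x : M A -> E A (E W x) = E A x.
Proof.
by move=> mA; rewrite -(pc_mul pcE)//; [rewrite setIidl//; exact: pc_sub | exact: pc_unit].
Qed.

Lemma sint_bound s K x : smeas s -> 0 <= K ->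
  (forall t, W t -> csq (sfun s t) <= K) -> nsq (sint s x) <= K * nsq x.
Proof.
move=> ms K0 bnd; have mW := pc_unit pcE.
have := @sint_bound_on s W 0 K x ms mW; rewrite scale0r add0r.
(* E W is only a projection, but it acts as the identity under the integral; its contractivity and 0
   <= K finish the estimate. *)
have -> : sint s (E W x) = sint s x.
  rewrite /sint [LHS]big_seq [RHS]big_seq; apply: eq_bigr => -[c A] /ms mA /=.
  by rewrite content_unit.
move=> h; apply: le_trans (h _) _; first by move=> t Wt; rewrite add0r bnd.
by rewrite ler_wpM2l//; apply: proj_contr (pc_proj pcE mW) x.
Qed.

Lemma sint_dist s s' e x : smeas s -> smeas s' -> 0 <= e ->
  (forall t, W t -> csq (sfun s t - sfun s' t) <= e) ->
  nsq (sint s x - sint s' x) <= e * nsq x.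
Proof.
move=> ms ms' e0 h; rewrite -sint_neg -sint_cat; apply: sint_bound => //.
  by apply: smeas_cat => //; exact: smeas_neg.
by move=> t Wt; rewrite sfun_cat sfun_neg h.
Qed.

(** The approximation clause of [spectral_integral], in squared form and over an arbitrary
    content. *)
Definition approx_int g T := forall e, 0 < e -> exists s,
  [/\ smeas s, forall t, W t -> csq (g t - sfun s t) <= e &
      forall x, nsq (T x - sint s x) <= e * nsq x].

Lemma approx_int_unique g g' T T' : (forall t, W t -> g t = g' t) ->
  approx_int g T -> approx_int g' T' -> T =1 T'.
Proof.
move=> gg' gT gT' x; apply/eqP; rewrite -subr_eq0; apply/eqP.
have x0 := nsq_ge0 x.
apply: (@nsq_small_eq0 _ _ _ (22 * nsq x)) => [|e e0]; first by lra.
have [s [ms gs Ts]] := gT e e0; have [s' [ms' gs' Ts']] := gT' e e0.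
have h : nsq (sint s x - sint s' x) <= 4 * e * nsq x.
  apply: sint_dist => //; first by lra.
  move=> t Wt; apply: le_trans (csqB2 _ (g t) _) _.
  by have := gs t Wt; have := gs' t Wt; rewrite -gg'// (csqBC (sfun s t)); lra.
apply: le_trans (nsqB2 _ (sint s x) _) _.
have := nsqB2 (sint s x) (sint s' x) (T' x).
have := Ts x; have := Ts' x; rewrite (nsqBC (T' x)).
have : 0 <= e * nsq x by rewrite mulr_ge0// ltW.
lra.
Qed.

Lemma approx_int_add g g' T T' : approx_int g T -> approx_int g' T' ->
  approx_int (fun t => g t + g' t) (fun x => T x + T' x).
Proof.
move=> gT gT' e e0; have e4 : 0 < e / 4 by lra.
have [s [ms gs Ts]] := gT _ e4; have [s' [ms' gs' Ts']] := gT' _ e4.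
exists (s ++ s'); split; first exact: smeas_cat.
- move=> t Wt; rewrite sfun_cat opprD addrACA; apply: le_trans (csqD2 _ _) _.
  by have := gs t Wt; have := gs' t Wt; lra.
- move=> x; rewrite sint_cat opprD addrACA; apply: le_trans (nsqD2 _ _) _.
  by have := Ts x; have := Ts' x; lra.
Qed.

Lemma approx_int_mul g g' T T' K :
  (forall t, W t -> csq (g t) <= K) -> (forall t, W t -> csq (g' t) <= K) ->
  approx_int g T -> approx_int g' T' ->
  approx_int (fun t => g t * g' t) (fun x => T (T' x)).
Proof.
move=> gK' g'K' gT gT'.
pose L := `|K|; have L0 : 0 <= L by exact: normr_ge0.
have KL : K <= L by exact: ler_norm.
have gK t : W t -> csq (g t) <= L by move=> /gK' h; exact: le_trans h KL.
have g'K t : W t -> csq (g' t) <= L by move=> /g'K' h; exact: le_trans h KL.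
move=> e e0.
(* The operator error is at most 2d (4L + 6) + 2 (2L + 2) d = d (12L + 16) times |x|^2; d <= 1 keeps
   the bounds on the approximants independent of e. *)
pose d := Num.min 1 (e / (12 * L + 16)).
have d0 : 0 < d by rewrite lt_min ltr01 divr_gt0//; lra.
have d1 : d <= 1 by rewrite ge_min lexx.
have de : d * (12 * L + 16) <= e.
  by rewrite -ler_pdivlMr; [rewrite ge_min lexx orbT | lra].
have [s [ms gs Ts]] := gT d d0; have [s' [ms' gs' Ts']] := gT' d d0.
have sL t : W t -> csq (sfun s t) <= 2 * L + 2.
  move=> Wt; have := csqD2 (g t) (- (g t - sfun s t)).
  have -> : g t - (g t - sfun s t) = sfun s t by rewrite opprB addrC subrK.
  by rewrite csqN; have := gK t Wt; have := gs t Wt; lra.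
have sL' t : W t -> csq (sfun s' t) <= 2 * L + 2.
  move=> Wt; have := csqD2 (g' t) (- (g' t - sfun s' t)).
  have -> : g' t - (g' t - sfun s' t) = sfun s' t by rewrite opprB addrC subrK.
  by rewrite csqN; have := g'K t Wt; have := gs' t Wt; lra.
have dL0 : 0 <= d * L by rewrite mulr_ge0// ltW.
exists (smul s s'); split; first exact: smeas_mul.
- move=> t Wt; rewrite sfun_mul.
  have -> : g t * g' t - sfun s t * sfun s' t =
      g t * (g' t - sfun s' t) + (g t - sfun s t) * sfun s' t by ring.
  apply: le_trans (csqD2 _ _) _; rewrite !csqM.
  have : csq (g t) * csq (g' t - sfun s' t) <= L * d.
    by rewrite ler_pM ?csq_ge0//; [exact: gK | exact: gs'].
  have : csq (g t - sfun s t) * csq (sfun s' t) <= d * (2 * L + 2).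
    by rewrite ler_pM ?csq_ge0//; [exact: gs | exact: sL'].
  lra.
- move=> x; rewrite sint_mul//.
  apply: le_trans (nsqB2 _ (sint s (T' x)) _) _.
  rewrite -(lin_B (sint_linear ms)).
  have h1 := Ts (T' x).
  have h2 : nsq (sint s (T' x - sint s' x)) <= (2 * L + 2) * nsq (T' x - sint s' x).
    by apply: sint_bound => //; lra.
  have h3 : nsq (T' x) <= (4 * L + 6) * nsq x.
    have := nsqD2 (T' x - sint s' x) (sint s' x); rewrite subrK.
    have : nsq (sint s' x) <= (2 * L + 2) * nsq x by apply: sint_bound => //; lra.
    have := Ts' x; have : d * nsq x <= 1 * nsq x by rewrite ler_wpM2r ?nsq_ge0.
    lra.
  have h4 : d * nsq (T' x) <= d * ((4 * L + 6) * nsq x) by rewrite ler_wpM2l ?(ltW d0).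
  have h5 : (2 * L + 2) * nsq (T' x - sint s' x) <= (2 * L + 2) * (d * nsq x).
    by rewrite ler_wpM2l//; lra.
  have h6 : d * (12 * L + 16) * nsq x <= e * nsq x by rewrite ler_wpM2r ?nsq_ge0.
  lra.
Qed.

(** Uniformly convergent simple functions have integrals that converge, by [sint_dist]. The set F
    carries a constraint on the coefficients along to the approximants. *)
Lemma exists_approx_int g (F : set (Cx R)) :
  (forall e, 0 < e -> exists s, [/\ smeas s, forall c A, (c, A) \in s -> F c &
     forall t, W t -> csq (g t - sfun s t) <= e]) ->
  exists T (f : nat -> simple), [/\ cont_op T, approx_int g T,
    forall n, smeas (f n) /\ forall c A, (c, A) \in f n -> F c &
    forall x, lims (fun n => sint (f n) x) (T x)].
Proof.
move=> gs.
have inv_gt0 n : (0 : R) < n.+1%:R^-1 by rewrite invr_gt0.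
have /choice[f hf] n := gs _ (inv_gt0 n).
have dist n s e : smeas s -> 0 <= e -> (forall t, W t -> csq (g t - sfun s t) <= e) ->
    forall x, nsq (sint (f n) x - sint s x) <= (2 * n.+1%:R^-1 + 2 * e) * nsq x.
  move=> ms e0 sg x; have [mf _ gf] := hf n; apply: sint_dist => //.
    by have := ltW (inv_gt0 n); move: (n.+1%:R^-1) => a; lra.
  move=> t Wt; apply: le_trans (csqB2 _ (g t) _) _.
  have := sg t Wt; have := gf t Wt; rewrite (csqBC (g t) (sfun (f n) t)).
  by move: (n.+1%:R^-1) => a; lra.
have cf x : cauchys (fun n => sint (f n) x).
  move=> e e0; have x1 : 0 < nsq x + 1 by have := nsq_ge0 x; lra.
  have [|N hN] := @inv_nat_small R (e / (4 * (nsq x + 1))); first by rewrite divr_gt0//; lra.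
  exists N => m n Nm Nn; have [mfn _ gfn] := hf n.
  apply: le_trans (dist m _ _ mfn (ltW (inv_gt0 n)) gfn x) _.
  have := hN m Nm; have := hN n Nn.
  have : e / (4 * (nsq x + 1)) * (4 * (nsq x + 1)) = e by rewrite divfK// gt_eqF//; lra.
  have := inv_gt0 n; have := inv_gt0 m; have := nsq_ge0 x.
  move: (m.+1%:R^-1) (n.+1%:R^-1) (nsq x) (e / _) => a b n2 q *.
  have : (a + b) * (n2 + 1) <= (2 * q) * (n2 + 1) by rewrite ler_wpM2r//; lra.
  lra.
have [T fT] := op_limit cf.
have lT : linear T by apply: (lim_linear fT) => n; apply: sint_linear; have [] := hf n.
have gT : approx_int g T.
  move=> e e0; have e2 : 0 < e / 2 by lra.
  have [s [ms _ sg]] := gs _ e2; exists s; split=> //.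
    by move=> t Wt; have := sg t Wt; lra.
  move=> x; apply: (@lims_nsq_le _ _ (fun n => sint (f n) x - sint s x)).
    by apply: limsB => //; exact: lims_cst.
  move=> d d0; have x1 : 0 < nsq x + 1 by have := nsq_ge0 x; lra.
  have [|N hN] := @inv_nat_small R (d / (2 * (nsq x + 1))); first by rewrite divr_gt0//; lra.
  exists N => n Nn; apply: le_trans (dist n _ _ ms (ltW e2) sg x) _.
  have := hN n Nn.
  have : d / (2 * (nsq x + 1)) * (2 * (nsq x + 1)) = d by rewrite divfK// gt_eqF//; lra.
  have := inv_gt0 n; have := nsq_ge0 x.
  move: (n.+1%:R^-1) (nsq x) (d / _) => a n2 q *.
  have : a * (n2 + 1) <= q * (n2 + 1) by rewrite ler_wpM2r//; lra.
  lra.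
exists T, f; split=> //.
- split=> //; have [s [ms _ Ts]] := gT 1 ltr01.
  have [_ [C [C0 hC]]] := sint_cont ms.
  exists (2 + 2 * C); split; first by lra.
  move=> x; have := nsqD2 (T x - sint s x) (sint s x); rewrite subrK.
  by have := Ts x; have := hC x; lra.
- by move=> n; have [] := hf n.
Qed.

(** Preimages of small discs about a finite net are made disjoint one after the other. Each receives
    as coefficient a value of g attained on it rather than the centre of the disc, so that
    coefficients stay in the range of g; the radius e / 4 absorbs this. *)
Lemma simple_approximation g K :
  (forall U : set (Cx R), open U -> M (W `&` g @^-1` U)) ->
  (forall t, W t -> csq (g t) <= K) ->
  forall e, 0 < e -> exists s, [/\ smeas s,
    forall c A, (c, A) \in s -> (g @` W) c &
    forall t, W t -> csq (g t - sfun s t) <= e].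
Proof.
move=> mg gK e e0; have e4 : 0 < e / 4 by lra.
have [cs hcs] := csq_net K e4.
(* B is the part not yet covered; the approximant vanishes off B, so the term for the next disc does
   not interfere with it. *)
suff main B : M B -> (forall t, B t -> exists2 c, c \in cs & csq (g t - c) < e / 4) ->
  exists s, [/\ smeas s, forall c A, (c, A) \in s -> (g @` W) c,
    forall t, ~ B t -> sfun s t = 0 & forall t, B t -> csq (g t - sfun s t) <= e].
  have [|s [ms sg _ gs]] := main W (pc_unit pcE); last by exists s.
  by move=> t Wt; exact/hcs/gK.
elim: cs B {hcs} => [|c cs IH] B mB hB.
  exists [::]; split=> //; first by move=> t _; rewrite /sfun big_nil.
  by move=> t /hB[].
pose U := [set w : Cx R | csq (w - c) < e / 4].
have oU : open U.
  have [q q0 q2] : exists2 q : R, 0 < q & e / 4 = q ^+ 2.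
    by exists (Num.sqrt (e / 4)); rewrite ?sqrtr_gt0// sqr_sqrtr ?ltW.
  have -> : U = ball c q%:C%C.
    by apply/seteqP; split=> w; rewrite -ball_normE /U /= csqBC q2 csq_lt ?ltW.
  by apply: ball_open; rewrite ltcR.
have mA := pc_setI pcE mB (mg _ oU); set A := B `&` _ in mA.
have inA t : B t -> csq (g t - c) < e / 4 -> A t.
  by move=> Bt gtc; split=> //; split=> //; exact: (pc_sub pcE mB).
have [||s [ms sg s0 gs]] := IH (B `\` A).
- exact: pc_setD.
- move=> t [Bt nAt]; have [c' c's gtc'] := hB t Bt; exists c' => //.
  by move: c's gtc'; rewrite inE => /orP[/eqP-> /(inA _ Bt)|].
have [[t0 At0]|A0] := pselect (exists t, A t); last first.
  have BA : B `\` A = B.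
    by apply/seteqP; split=> [t []//|t Bt]; split=> // At; apply: A0; exists t.
  by exists s; rewrite BA in s0 gs.
exists ((g t0, A) :: s); split.
- exact/smeas_cons.
- move=> c' A'; rewrite inE => /orP[/eqP[-> _]|/sg//].
  by exists t0 => //; apply: (pc_sub pcE mB); case: At0.
- move=> t nBt; rewrite /sfun big_cons /= indicE memNset; last by case.
  by rewrite mulr0 add0r; apply: s0; case.
- move=> t Bt; rewrite /sfun big_cons /= indicE -/(sfun s t).
  have [At|nAt] := pselect (A t); last by rewrite memNset// mulr0 add0r; exact: gs.
  rewrite mem_set// mulr1 s0 ?addr0; last by case.
  apply: le_trans (csqB2 _ c _) _.
  have [_ [_ h1]] := At; have [_ [_ h2]] := At0.
  by move: h1 h2; rewrite /U /= (csqBC (g t0)); lra.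
Qed.

End SimpleIntegrals.

(** * Complex-valued forms and spectral integrals *)

Section ComplexBridge.
Context {R : realType} {H : hilbertSpace R}.
Implicit Types (x y : H) (T : H -> H).

(** By conjugate linearity in the second argument; with it, complex identities for complex linear
    operators reduce to real ones for [ip]. *)
Lemma Im_hdot x y : complex.Im (hdot H x y) = ip x (('i)%C *: y).
Proof.
rewrite /ip linearZr_LR /= ReM.
have -> : complex.Re (('i)%C : Cx R)^* = 0 by exact: erefl.
have -> : complex.Im (('i)%C : Cx R)^* = - 1 by exact: erefl.
by rewrite mul0r sub0r mulN1r opprK.
Qed.

Lemma sym_hdot T x y : linear T -> sym_op T -> hdot H (T x) y = hdot H x (T y).
Proof.
move=> lT sT; apply/eqP; rewrite eq_complex; apply/andP; split; apply/eqP.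
  exact: sT.
by rewrite !Im_hdot sT (lin_Zc lT).
Qed.

Lemma nonneg_pos T : nonneg_operator T -> pos_op T.
Proof. by move=> pT x; have := pT x; rewrite lecE => /andP[]. Qed.

(* Polarization: the form is real at x + iy. *)
Lemma nonneg_sym T : linear T -> nonneg_operator T -> sym_op T.
Proof.
move=> lT pT.
have im0 z : complex.Im (hdot H (T z) z) = 0.
  by have := pT z; rewrite lecE => /andP[/eqP].
move=> x y; rewrite (ipC x).
have := im0 (x + ('i)%C *: y); rewrite (lin_D lT) (lin_Zc lT) Im_hdot.
have ii z : ('i : Cx R)%C *: (('i : Cx R)%C *: z) = - z.
  by rewrite scalerA -expr2 sqr_i scaleN1r.
rewrite scalerDr ii !ipE -!Im_hdot im0.
have iy : complex.Im (hdot H (('i)%C *: T y) x) = ip (T y) x.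
  rewrite linearZl_LR /= /ip; case: (hdot H (T y) x) => a b /=.
  by rewrite mul0r mul1r add0r.
have -> : ip (('i)%C *: T y) y = - complex.Im (hdot H (T y) y).
  rewrite /ip linearZl_LR /=; case: (hdot H (T y) y) => a b /=.
  by rewrite mul0r mul1r sub0r.
by rewrite iy im0; lra.
Qed.

Lemma sym_pos_nonneg T : linear T -> sym_op T -> pos_op T -> nonneg_operator T.
Proof.
move=> lT sT pT x; rewrite lecE; apply/andP; split; last exact: pT.
have := sym_hdot x x lT sT; rewrite (hdotC x).
case: (hdot H (T x) x) => a b /= [hb]; apply/eqP; lra.
Qed.

Lemma bounded_cont T : bounded_operator T -> cont_op T.
Proof.
move=> [lT [M hM]]; split=> //.
exists (csq M); split; first exact: csq_ge0.
(* M is an arbitrary complex number, but M times |x| dominates a norm, hence is nonnegative and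
   equals its own modulus. *)
move=> x; have nx : 0 <= M * `|x| by apply: le_trans (hM x).
have := hM x; rewrite -(ger0_norm nx) normrM normr_id => h.
rewrite -lecR rmorphM /= !nsq_norm csq_norm -exprMn.
by rewrite ler_sqr ?nnegrE ?normr_ge0// mulr_ge0.
Qed.

Lemma cont_bounded T : cont_op T -> bounded_operator T.
Proof.
move=> [lT [C [C0 hC]]]; split=> //; exists (Num.sqrt C)%:C%C => x.
by apply/norm_le_nsq; rewrite ?sqrtr_ge0// sqr_sqrtr.
Qed.

Lemma proj_orthogonal T : proj_op T -> orthogonal_projection T.
Proof.
move=> pT; have [lT sT TT] := pT; split=> //.
  exact/cont_bounded/proj_cont.
by move=> x y; exact: sym_hdot.
Qed.

End ComplexBridge.

Section SpectralIntegral.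
Context {R : realType} {H : hilbertSpace R}.
Variable Pi : set (Cx R) -> H -> H.
Implicit Types (g : Cx R -> Cx R) (T : H -> H).

Local Notation approx := (@approx_int R H (Cx R) Cplus borel_Cplus Pi).

Lemma spectral_approx g T : spectral_integral Pi g T -> approx g T.
Proof.
move=> [_ _ gT] e e0; have se0 : 0 < Num.sqrt e by rewrite sqrtr_gt0.
have [|s [ms gs Ts]] := gT (Num.sqrt e)%:C%C; first by rewrite ltcR.
have e2 : e = Num.sqrt e ^+ 2 by rewrite sqr_sqrtr ?ltW.
exists s; split=> //.
  by move=> t Wt; rewrite e2 csq_le ?(ltW se0)//; exact: gs.
move=> x; rewrite [X in X * _]e2; apply/norm_le_nsq; first exact: ltW.
exact: Ts.
Qed.

Lemma approx_spectral g T : bounded_borel g -> cont_op T -> approx g T ->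
  spectral_integral Pi g T.
Proof.
move=> bg cT gT; split=> //; first exact: cont_bounded.
move=> eps eps0.
have /complex_realP[e ee] : eps \is Num.real by rewrite gtr0_real.
have e0 : 0 < e by rewrite -ltcR -ee.
have [s [ms gs Ts]] := gT _ (exprn_gt0 2 e0); exists s; split=> //.
  by move=> z Wz; rewrite ee -csq_le ?(ltW e0)//; exact: gs.
by move=> x; rewrite ee; apply/norm_le_nsq; [exact: ltW | exact: Ts].
Qed.

End SpectralIntegral.

(** * Borel sets and cutoff functions on the closed quadrant *)

Section ComplexPlane.
Context {R : realType}.
Implicit Types (z w : Cx R) (a b e L : R) (A B U : set (Cx R)).

Lemma near_csq z e : 0 < e -> \forall w \near z, csq (z - w) <= e.
Proof.
move=> e0; have se0 : 0 < Num.sqrt e by rewrite sqrtr_gt0.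
near=> w; rewrite -[e]sqr_sqrtr ?(ltW e0)// csq_le ?(ltW se0)//.
by near: w; apply: cvgr_dist_le; [exact: cvg_id | rewrite ltcR].
Unshelve. all: by end_near. Qed.

Lemma cvg_csq (T : Type) (F : set_system T) {FF : Filter F} (f : T -> Cx R) z :
  (forall e, 0 < e -> \forall t \near F, csq (z - f t) <= e) -> f @ F --> z.
Proof.
move=> h; apply/cvgrPdist_le => eps eps0.
have /complex_realP[e ee] : eps \is Num.real by rewrite gtr0_real.
have e0 : 0 < e by rewrite -ltcR -ee.
have := h _ (exprn_gt0 2 e0); apply: filterS => t.
by rewrite csq_le ?(ltW e0)// -ee.
Qed.

Lemma csq_Re_le z e : 0 <= e -> csq z <= e ^+ 2 -> `|complex.Re z| <= e.
Proof.
move=> e0 ze; rewrite -(ger0_norm e0) -ler_sqr ?nnegrE//.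
rewrite !real_normK ?num_real//; apply: le_trans ze.
by rewrite /csq lerDl sqr_ge0.
Qed.

Lemma csq_Im_le z e : 0 <= e -> csq z <= e ^+ 2 -> `|complex.Im z| <= e.
Proof.
move=> e0 ze; rewrite -(ger0_norm e0) -ler_sqr ?nnegrE//.
rewrite !real_normK ?num_real//; apply: le_trans ze.
by rewrite /csq lerDr sqr_ge0.
Qed.

Lemma ReB z w : complex.Re (z - w) = complex.Re z - complex.Re w.
Proof. by case: z w => [a b] [c d]. Qed.

Lemma ImB z w : complex.Im (z - w) = complex.Im z - complex.Im w.
Proof. by case: z w => [a b] [c d]. Qed.

Lemma Re_continuous : continuous (fun z : Cx R => complex.Re z).
Proof.
move=> z; apply/(@cvgrPdist_le _ _ _ (nbhs z)) => e e0; near=> w.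
rewrite -ReB; apply: csq_Re_le; first exact: ltW.
by near: w; apply: near_csq; exact: exprn_gt0.
Unshelve. all: by end_near. Qed.

Lemma Im_continuous : continuous (fun z : Cx R => complex.Im z).
Proof.
move=> z; apply/(@cvgrPdist_le _ _ _ (nbhs z)) => e e0; near=> w.
rewrite -ImB; apply: csq_Im_le; first exact: ltW.
by near: w; apply: near_csq; exact: exprn_gt0.
Unshelve. all: by end_near. Qed.

Lemma csq_real a : csq (a%:C%C : Cx R) = a ^+ 2.
Proof. by rewrite /csq /= expr0n addr0. Qed.

Lemma real_complex_continuous : continuous (fun a : R => a%:C%C : Cx R).
Proof.
move=> a; apply: (@cvg_csq _ (nbhs a)) => e e0; near=> b.
have se0 : 0 < Num.sqrt e by rewrite sqrtr_gt0.
rewrite -rmorphB csq_real -[e]sqr_sqrtr ?(ltW e0)//.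
rewrite -real_normK ?num_real// ler_sqr ?nnegrE ?(ltW se0)//.
by near: b; apply: cvgr_dist_le; [exact: cvg_id | rewrite sqrtr_gt0].
Unshelve. all: by end_near. Qed.

Definition box L : set (Cx R) :=
  [set z | 0 <= complex.Re z <= L /\ 0 <= complex.Im z <= L].

Lemma box_Cplus L : box L `<=` Cplus.
Proof. by move=> z [/andP[? _] /andP[? _]]. Qed.

Lemma compact_box L : compact (box L).
Proof.
pose f (p : R * R) : Cx R := (p.1 +i* p.2)%C.
have cf : continuous f.
  move=> [a b]; apply: (@cvg_csq _ (nbhs (a, b))) => e e0.
  have e2 : 0 < e / 2 by lra.
  have d0 : 0 < Num.sqrt (e / 2) by rewrite sqrtr_gt0.
  have d2 : Num.sqrt (e / 2) ^+ 2 = e / 2 by rewrite sqr_sqrtr ?ltW.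
  near=> p.
  have h1 : `|a - p.1| <= Num.sqrt (e / 2).
    by near: p; apply: cvgr_dist_le d0; exact: cvg_fst.
  have h2 : `|b - p.2| <= Num.sqrt (e / 2).
    by near: p; apply: cvgr_dist_le d0; exact: cvg_snd.
  rewrite /csq /f ReB ImB /=.
  rewrite -ler_sqr ?nnegrE ?(ltW d0)// real_normK ?num_real// in h1.
  rewrite -ler_sqr ?nnegrE ?(ltW d0)// real_normK ?num_real// in h2.
  lra.
have -> : box L = f @` (`[0, L] `*` `[0, L]).
  apply/seteqP; split=> [[a b] /= [aL bL]|_ [[a b] /= [aL bL] <-]].
    by exists (a, b) => //=; rewrite !in_itv.
  by move: aL bL; rewrite !in_itv.
apply: continuous_compact; first exact: continuous_subspaceT.
by apply: compact_setX; exact: segment_compact.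
Unshelve. all: by end_near. Qed.

Lemma closed_Cplus : closed (@Cplus R).
Proof.
have -> : @Cplus R = (fun z => complex.Re z) @^-1` [set a | 0 <= a] `&`
    (fun z => complex.Im z) @^-1` [set a | 0 <= a] by [].
apply: closedI; apply: preimage_closed; try exact: closed_ge.
  by move=> z _; exact: Re_continuous.
by move=> z _; exact: Im_continuous.
Qed.

Lemma closed_box L : closed (box L).
Proof. by apply: compact_closed; [exact: norm_hausdorff | exact: compact_box]. Qed.

Lemma compact_supp (g : Cx R -> Cx R) L :
  (forall z, Cplus z -> g z != 0 -> box L z) -> compact (supp g).
Proof.
move=> gL; apply: (subclosed_compact _ (@compact_box L)).
  by apply: closedI; [exact: closed_Cplus | exact: closed_closure].
move=> z [_]; rewrite [box L](closure_id _).1; last exact: closed_box.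
by apply: closureS => w [Cw gw]; exact: gL.
Qed.

Lemma borel_sub A : borel_Cplus A -> A `<=` @Cplus R.
Proof.
apply: (@smallest_sub _ (sigma_algebra (@Cplus R)) _ [set A | A `<=` Cplus]).
  split=> // [B BC z []//|F FC z [n _ Fz]]; exact: FC Fz.
by move=> _ [U oU <-] z [].
Qed.

Lemma borel_sigma : sigma_algebra (@Cplus R) (@borel_Cplus R).
Proof. exact: smallest_sigma_algebra. Qed.

Lemma borel_algebra : [/\ borel_Cplus (@Cplus R),
  (forall A B, borel_Cplus A -> borel_Cplus B -> borel_Cplus (A `&` B)),
  (forall A B, borel_Cplus A -> borel_Cplus B -> borel_Cplus (A `|` B)) &
  (forall A B, borel_Cplus A -> borel_Cplus B -> borel_Cplus (A `\` B))].
Proof.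
have [CC _ _ CI] := (sigma_algebraP (@borel_sub)).1 borel_sigma.
have [_ CD _] := borel_sigma; split=> // A B bA bB.
  have -> : A `|` B = Cplus `\` ((Cplus `\` A) `&` (Cplus `\` B)).
    apply/seteqP; split=> z; last first.
      by move=> [Cz /not_andP[] h]; [left|right]; apply: contrapT => k; exact: h.
    by move=> [h|h]; split; [exact: borel_sub h|case=> -[]|exact: borel_sub h|case=> _ []].
  by apply: (CD); apply: CI; exact: CD.
have -> : A `\` B = A `&` (Cplus `\` B).
  apply/seteqP; split=> z [Az Bz]; split=> //; last by case: Bz.
  by split=> //; exact: borel_sub Az.
by apply: CI => //; exact: CD.
Qed.

Lemma borel_open U : open U -> borel_Cplus (Cplus `&` U).
Proof. by move=> oU; apply: sub_sigma_algebra; exists U. Qed.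

Lemma continuous_borel (g : Cx R -> Cx R) L : continuous g ->
  (forall z, Cplus z -> csq (g z) <= L ^+ 2) -> 0 <= L -> bounded_borel g.
Proof.
move=> cg gL L0; split.
  by move=> U oU; apply: borel_open; apply: open_comp => // z _; exact: cg.
by exists L%:C%C => z Cz; rewrite -csq_le// gL.
Qed.

Lemma bounded_borel_csq (g : Cx R -> Cx R) : bounded_borel g ->
  exists K : R, forall z, Cplus z -> csq (g z) <= K.
Proof.
move=> [_ [M gM]]; exists (csq M) => z /gM h.
rewrite -lecR !csq_norm ler_sqr ?nnegrE ?normr_ge0//.
by apply: (le_trans h (real_ler_norm _)); rewrite ger0_real// (le_trans _ h).
Qed.

End ComplexPlane.

Section CutoffFunctions.
Context {R : realType}.
Implicit Types (z : Cx R) (a b L : R).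

(** On the square of side L the minimum is a, as 2a + b <= 3L there; beyond a + b = 3L the second
    term is negative and the cutoff vanishes. *)
Definition cutoff L a b : R := Num.max 0 (Num.min a (3 * L - a - b)).

Lemma cutoff_ge0 L a b : 0 <= cutoff L a b.
Proof. by rewrite /cutoff le_max lexx. Qed.

Lemma cutoff_id L a b : 0 <= a <= L -> 0 <= b <= L -> cutoff L a b = a.
Proof.
move=> ha hb; rewrite /cutoff min_l; last by lra.
by rewrite max_r//; case/andP: ha.
Qed.

Lemma cutoff_supp L a b : 0 <= a -> 0 <= b -> 0 <= L -> cutoff L a b != 0 ->
  0 <= a <= 3 * L /\ 0 <= b <= 3 * L.
Proof.
move=> a0 b0 L0; have [h|h] := leP (a + b) (3 * L); first by move=> _; split; lra.
case/eqP; rewrite /cutoff min_r; last by lra.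
by rewrite max_l; lra.
Qed.

Lemma cutoff_le L a b : 0 <= a -> 0 <= b -> 0 <= L -> cutoff L a b <= 3 * L.
Proof.
move=> a0 b0 L0; rewrite /cutoff ge_max; apply/andP; split; first by lra.
by rewrite ge_min; apply/orP; right; lra.
Qed.

Lemma complexify_continuous (f : Cx R -> R) : continuous f ->
  continuous (fun z => (f z)%:C%C : Cx R).
Proof.
move=> cf z; apply: (@continuous_comp _ _ _ f (fun a : R => a%:C%C : Cx R)).
  exact: cf.
exact: real_complex_continuous.
Qed.

Lemma cutoff_continuous L (f g : Cx R -> R) : continuous f -> continuous g ->
  continuous (fun z => cutoff L (f z) (g z)).
Proof.
move=> cf cg z.
apply: (@continuous_max R (Cx R) (fun=> 0) (fun z => Num.min (f z) (3 * L - f z - g z))).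
  exact: (@cst_continuous _ _ (0 : R)).
apply: (@continuous_min R (Cx R) f (fun z => 3 * L - f z - g z)); first exact: cf.
exact: cvgB (cvgB (cvg_cst (3 * L)) (cf z)) (cg z).
Qed.

Definition cutRe L z : R := cutoff L (complex.Re z) (complex.Im z).
Definition cutIm L z : R := cutoff L (complex.Im z) (complex.Re z).

Lemma cutRe_continuous L : continuous (cutRe L).
Proof. by apply: cutoff_continuous; [exact: Re_continuous | exact: Im_continuous]. Qed.

Lemma cutIm_continuous L : continuous (cutIm L).
Proof. by apply: cutoff_continuous; [exact: Im_continuous | exact: Re_continuous]. Qed.

Lemma cut_Cc L : 0 <= L -> Cc_Cplus (fun z => (cutRe L z)%:C%C) /\
  Cc_Cplus (fun z => (cutIm L z)%:C%C).
Proof.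
have supp0 a : (a%:C%C : Cx R) != 0 -> a != 0.
  by apply: contra_neq => ->.
move=> L0; split; split.
- exact/continuous_subspaceT/complexify_continuous/cutRe_continuous.
- apply: (@compact_supp _ _ (3 * L)) => z [z1 z2] /supp0 h.
  exact: cutoff_supp h.
- exact/continuous_subspaceT/complexify_continuous/cutIm_continuous.
- apply: (@compact_supp _ _ (3 * L)) => z [z1 z2] /supp0 h.
  by have [] := cutoff_supp z2 z1 L0 h.
Qed.

Lemma cut_bounded L z : 0 <= L -> Cplus z ->
  csq ((cutRe L z)%:C%C : Cx R) <= (3 * L) ^+ 2 /\
  csq ((cutIm L z)%:C%C : Cx R) <= (3 * L) ^+ 2.
Proof.
move=> L0 [z1 z2]; rewrite !csq_real.
by split; rewrite ler_sqr ?nnegrE ?cutoff_ge0 ?mulr_ge0 ?cutoff_le.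
Qed.

(** * The symbol of the filter as a bounded Borel function *)

Section FilterSymbol.
Variables (fu fw : Cx R -> R).
Hypotheses (fu0 : forall z, 0 <= fu z) (fw0 : forall z, 0 <= fw z).
Hypotheses (cu : continuous fu) (cw : continuous fw).

Local Notation Fs := (filter_symbol (fun z => (fu z)%:C%C) (fun z => (fw z)%:C%C)).

Lemma filter_symbolE z : Cplus z -> Fs z = (fu z / (fu z + fw z))%:C%C.
Proof.
move=> Cz; rewrite /filter_symbol; case: ifPn => [/eqP/complexI ->|fz].
  by rewrite mul0r.
rewrite indicE mem_set ?mulr1; first by rewrite -rmorphD -fmorphV -rmorphM.
by split=> //; apply: subset_closure.
Qed.

Lemma filter_symbol_bounds z : 0 <= fu z / (fu z + fw z) <= 1.
Proof.
have := fu0 z; have := fw0 z => w0 u0.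
rewrite divr_ge0 ?addr_ge0//=.
(* At a zero denominator the quotient is 0, since the inverse of 0 is 0. *)
have [s0|s0] := eqVneq (fu z + fw z) 0; first by rewrite s0 invr0 mulr0.
by rewrite ler_pdivrMr ?mul1r ?lerDl// lt_neqAle eq_sym s0 addr_ge0.
Qed.

(** The symbol is continuous on the open set where fu is nonzero and vanishes elsewhere, so a
    preimage is relatively open, joined with the zero set of fu when the target contains 0. *)
Lemma filter_symbol_borel : bounded_borel Fs.
Proof.
have bnd z : Cplus z -> `|Fs z| <= 1.
  move=> Cz; rewrite filter_symbolE// -[X in _ <= X]/(1%:C%C) -csq_le// csq_real.
  by have /andP[h1 h2] := filter_symbol_bounds z; rewrite ler_sqr ?nnegrE.
split; last by exists 1.
move=> U oU; have [CC CI CU CD] := @borel_algebra R.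
pose O := [set z : Cx R | fu z != 0].
have oO : open O.
  rewrite (_ : O = fu @^-1` [set a | a != 0])//.
  by apply: open_comp => [z _|]; [exact: cu | exact: open_neq].
pose q z : Cx R := (fu z / (fu z + fw z))%:C%C.
have oV : open (O `&` q @^-1` U).
  rewrite openE => z [Oz Uz]; apply: filterI; first by apply: open_nbhs_nbhs.
  have s0 : fu z + fw z != 0.
    have : 0 < fu z by rewrite lt_neqAle fu0 andbT eq_sym.
    by have := fw0 z => h1 h2; rewrite gt_eqF//; lra.
  have cq : {for z, continuous q}.
    apply: (@continuous_comp _ _ _ (fun z => fu z / (fu z + fw z))
      (fun a : R => a%:C%C : Cx R)); last exact: real_complex_continuous.
    exact: cvgM (@cu z) (cvgV s0 (cvgD (@cu z) (@cw z))).
  by apply: cq; apply: open_nbhs_nbhs.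
have Fs0 z : ~ O z -> Fs z = 0.
  by move/negP; rewrite negbK /filter_symbol => /eqP ->; rewrite eqxx.
have bV := borel_open oV.
have [U0|U0] := pselect (U 0).
  have -> : Cplus `&` Fs @^-1` U =
      (Cplus `&` (O `&` q @^-1` U)) `|` (Cplus `\` (Cplus `&` O)).
    apply/seteqP; split=> z /=.
      move=> [Cz Uz]; have [Oz|nOz] := pselect (O z); last by right; split=> // -[].
      by left; split=> //; split=> //; move: Uz; rewrite filter_symbolE.
    move=> [[Cz [Oz Uz]]|[Cz nO]]; split=> //; first by rewrite filter_symbolE.
    by rewrite Fs0// => Oz; exact: nO.
  by apply: CU => //; apply: CD => //; exact: borel_open.
have -> // : Cplus `&` Fs @^-1` U = Cplus `&` (O `&` q @^-1` U).
apply/seteqP; split=> z /= [Cz].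
  move=> Uz; split=> //; split; last by move: Uz; rewrite filter_symbolE.
  by apply: contrapT => nO; apply: U0; rewrite -(Fs0 z).
by move=> [Oz Uz]; split=> //; rewrite filter_symbolE.
Qed.

End FilterSymbol.

End CutoffFunctions.

(** * The push-forward to the quadrant *)

Section BinaryExpansion.
Context {R : realType}.
Implicit Types (f g : nat -> bool).

Definition bin_sum f n : R := \sum_(k < n) 2^-1 ^+ k.+1 * (f k)%:R.
Definition bin_exp f : R := sup (range (bin_sum f)).

Lemma half_exp_gt0 n : 0 < (2^-1 : R) ^+ n.
Proof. by rewrite exprn_gt0// invr_gt0. Qed.

Lemma bin_sum_mono f : {homo bin_sum f : m n / (m <= n)%N >-> m <= n}.
Proof.
apply/nondecreasing_seqP => n; rewrite /bin_sum big_ord_recr /= lerDl.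
by rewrite mulr_ge0// ltW// half_exp_gt0.
Qed.

Lemma bin_sum_tail f n k :
  bin_sum f (n + k) <= bin_sum f n + (2^-1 ^+ n - 2^-1 ^+ (n + k)).
Proof.
elim: k => [|k IH]; first by rewrite addn0 subrr addr0.
rewrite addnS /bin_sum big_ord_recr /= -/(bin_sum f (n + k)).
have : 2^-1 ^+ (n + k).+1 * (f (n + k)%N)%:R <= (2^-1 : R) ^+ (n + k).+1.
  by rewrite ler_piMr ?(ltW (half_exp_gt0 _))//; case: (f _).
move: IH; rewrite exprS; move: (_ ^+ (n + k)) (_ ^+ n) => a b; rewrite /bin_sum; lra.
Qed.

Lemma bin_sum_le f m n : bin_sum f m <= bin_sum f n + 2^-1 ^+ n.
Proof.
have hn := half_exp_gt0 n.
have [mn|/ltnW nm] := leqP m n; first by have := bin_sum_mono f mn; lra.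
have := bin_sum_tail f n (m - n); rewrite subnKC//.
by have := half_exp_gt0 m; lra.
Qed.

Lemma bin_exp_bounds f n : bin_sum f n <= bin_exp f <= bin_sum f n + 2^-1 ^+ n.
Proof.
apply/andP; split.
  apply: ub_le_sup; last by exists n.
  by exists (bin_sum f 0 + 2^-1 ^+ 0) => _ [m _ <-]; exact: bin_sum_le.
apply: ge_sup; first by exists (bin_sum f 0), 0%N.
by move=> _ [m _ <-]; exact: bin_sum_le.
Qed.

Lemma bin_exp_itv f : 0 <= bin_exp f <= 1.
Proof. by have := bin_exp_bounds f 0; rewrite /bin_sum big_ord0 add0r expr0. Qed.

Lemma bin_exp0 : bin_exp (fun=> false) = 0.
Proof.
have s0 n : bin_sum (fun=> false) n = 0.
  by rewrite /bin_sum big1// => k _; rewrite mulr0.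
apply/eqP; rewrite eq_le; have /andP[-> _] := bin_exp_itv (fun=> false).
rewrite andbT; apply: ge_sup; first by exists (bin_sum (fun=> false) 0), 0%N.
by move=> _ [n _ <-]; rewrite s0.
Qed.

Lemma bin_exp_close f g n : (forall k, (k < n)%N -> f k = g k) ->
  `|bin_exp f - bin_exp g| <= 2^-1 ^+ n.
Proof.
move=> fg; have : bin_sum f n = bin_sum g n.
  by apply: eq_bigr => k _; rewrite fg.
have := bin_exp_bounds f n; have := bin_exp_bounds g n.
by rewrite ler_norml; move: (2^-1 ^+ n) => a; lra.
Qed.

Lemma half_exp_small (e : R) : 0 < e -> exists n, 2^-1 ^+ n <= e.
Proof.
move=> e0; exists (Num.trunc e^-1).+1.
apply: (@le_trans _ _ (Num.trunc e^-1).+1%:R^-1).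
  rewrite exprVn lef_pV2 ?posrE ?exprn_gt0// -natrX ler_nat.
  by apply: ltnW; exact: ltn_expl.
by rewrite invf_ple ?posrE ?ltr0n// ltW// truncnS_gt.
Qed.

End BinaryExpansion.

(** * The image measure on the quadrant and the integrals of the coordinates *)

Section PlaneMeasure.
Context {R : realType} {H : hilbertSpace R}.
Implicit Types (x y : H) (p : nat -> bool) (A B : set (Cx R)).
Variable r : nat -> H -> H.
Hypothesis r_proj : forall n, proj_op (r n).
Hypothesis r_comm : forall m n, commutes (r m) (r n).
Variable L : R.
Hypothesis L0 : 0 < L.

Local Notation E := (cmeasure r_proj r_comm).
Local Notation cmeas := (cmeasurable r).

(* The even and the odd coordinates are the binary digits of the real and the
   imaginary part. *)
Definition plane_point p : Cx R :=
  ((L * bin_exp (fun k => p k.*2)) +i* (L * bin_exp (fun k => p k.*2.+1)))%C.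

Local Notation h := plane_point.

Lemma plane_point_box p : box L (h p).
Proof.
have := bin_exp_itv (R := R) (fun k => p k.*2).
have := bin_exp_itv (R := R) (fun k => p k.*2.+1).
by move=> /andP[a b] /andP[c d]; split; rewrite /= mulr_ge0 ?(ltW L0)// ler_piMr ?(ltW L0).
Qed.

Lemma plane_point_Cplus p : Cplus (h p).
Proof. exact/box_Cplus/plane_point_box. Qed.

Lemma plane_point0 : h (fun=> false) = 0.
Proof. by rewrite /h bin_exp0 mulr0. Qed.

Lemma plane_point_close p p' n : (forall k, (k < n.*2)%N -> p k = p' k) ->
  csq (h p - h p') <= 2 * (L * 2^-1 ^+ n) ^+ 2.
Proof.
move=> pp; rewrite /csq /h ReB ImB /= -!mulrBr.
have sq (a : R) : `|a| <= 2^-1 ^+ n -> (L * a) ^+ 2 <= (L * 2^-1 ^+ n) ^+ 2.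
  move=> an; rewrite !exprMn ler_wpM2l ?sqr_ge0//.
  by rewrite -real_normK ?num_real// ler_sqr ?nnegrE// ltW// half_exp_gt0.
rewrite mulr_natl; apply: lerD; apply: sq; apply: bin_exp_close => k kn; apply: pp.
  by rewrite ltn_double.
by rewrite -doubleS leq_double.
Qed.

(** Induction on the number of relevant bits: S is glued along the clopen set of bit n from the two
    sets obtained by forcing that bit, which depend on the first n bits only. *)
Lemma cmeasurable_cylinder n (S : set (nat -> bool)) :
  (forall p p', (forall k, (k < n)%N -> p k = p' k) -> S p -> S p') -> cmeas S.
Proof.
elim: n S => [|n IH] S hS.
  have [[p Sp]|S0] := pselect (exists p, S p).
    rewrite (_ : S = ~` set0); first exact/cmeasurableC/cmeasurable0.
    by apply/seteqP; split=> p' _; [case | apply: hS Sp].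
  rewrite (_ : S = set0); first exact: cmeasurable0.
  by apply/seteqP; split=> // p Sp; apply: S0; exists p.
pose up b p k := if k == n then b else p k.
pose D := [set p : nat -> bool | cmem (CBit n) p].
have mS b : cmeas [set p | S (up b p)].
  apply: IH => p p' pp /=; apply: hS => k; rewrite ltnS /up.
  by have [//|kn] := eqVneq k n; rewrite leq_eqVlt (negbTE kn); exact: pp.
have mD : cmeas D by exact: (cmeasurable_clopen r_proj r_comm (CBit _)).
rewrite (_ : S = (D `&` [set p | S (up true p)]) `|` (~` D `&` [set p | S (up false p)])).
  by apply: cmeasurableU => //; apply: cmeasurableI => //; exact: cmeasurableC.
have upE p : up (p n) p = p.
  by apply/funext => k; rewrite /up; case: eqP => // ->.
apply/seteqP; split=> p.
  move=> Sp; case pn: (p n); [left|right]; split; rewrite /D/= ?pn//.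
    by rewrite -pn upE.
  by rewrite -pn upE.
by case=> -[]; rewrite /D /= => pn; [rewrite -[in true]pn|move/negP: pn => /negbTE <-]; rewrite upE.
Qed.

(** The point depends continuously on the digits: the preimage of an open set is the countable union
    over n of the cylinders of depth 2n that it contains. *)
Lemma cmeasurable_borel A : borel_Cplus A -> cmeas (h @^-1` A).
Proof.
apply: (@smallest_sub _ (sigma_algebra (@Cplus R)) _ [set A | cmeas (h @^-1` A)]).
  split.
  - by rewrite /= preimage_set0; exact: cmeasurable0.
  - move=> B mB /=; rewrite (_ : _ @^-1` _ = ~` (h @^-1` B)).
      exact: cmeasurableC.
    by apply/seteqP; split=> p /= => [[]//|nB]; split=> //; exact: plane_point_Cplus.
  - by move=> F mF /=; rewrite preimage_bigcup; exact: cmeasurable_bigcup.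
move=> _ [U oU <-] /=.
pose cyl n := [set p | forall p', (forall k, (k < n.*2)%N -> p k = p' k) -> U (h p')].
rewrite (_ : _ @^-1` _ = \bigcup_n cyl n).
  apply: (cmeasurable_bigcup r_proj r_comm) => n; apply: (@cmeasurable_cylinder n.*2) => p p' pp Sp q pq.
  by apply: Sp => k kn; rewrite pp// pq.
apply/seteqP; split=> p /=; last first.
  by move=> [n _ /(_ p (fun _ _ => erefl))] Up; split=> //; exact: plane_point_Cplus.
move=> [_ Up]; have /nbhs_ballP[eps eps0 hU] : nbhs (h p) U by apply: open_nbhs_nbhs.
have /complex_realP[e ee] : eps \is Num.real by rewrite gtr0_real.
have e0 : 0 < e by rewrite -ltcR -ee.
(* L 2^-n <= e / 2 makes the bound 2 (L 2^-n)^2 at most e^2 / 2. *)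
have [|n hn] := @half_exp_small R (e / (2 * L)); first by rewrite divr_gt0// mulr_gt0.
exists n => // p' pp; apply: hU; rewrite -ball_normE /= ee -csq_lt ?(ltW e0)//.
apply: le_lt_trans (plane_point_close pp) _.
rewrite ler_pdivlMr ?mulr_gt0// in hn.
have := half_exp_gt0 (R := R) n; move: (2^-1 ^+ n) hn => a hn a0.
have La : 0 < L * a by rewrite mulr_gt0.
by rewrite !expr2; nra.
Qed.

(* Uniqueness of the filter forces the common kernel of the two operators, which
   lives at the point 0, to be removed. *)
Definition plane_measure A : H -> H := E (h @^-1` (A `\ 0)).

Local Notation Pi := plane_measure.

Lemma borel_setD0 A : borel_Cplus A -> borel_Cplus (A `\ (0 : Cx R)).
Proof.
move=> bA; have [_ _ _ CD] := @borel_algebra R.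
have -> : A `\ (0 : Cx R) = A `\` (Cplus `\` (Cplus `&` [set~ 0])).
  apply/seteqP; split=> z /= [Az nz]; split=> //.
    by move=> [Cz h1]; apply: h1; split.
  by move=> z0; apply: nz; split; [exact: borel_sub Az | move=> [_]; apply].
apply: (CD) => //; apply: CD; first by have [] := @borel_algebra R.
apply: borel_open; apply: closed_openC; apply: compact_closed; first exact: norm_hausdorff.
exact: compact_set1.
Qed.

Lemma plane_cmeas A : borel_Cplus A -> cmeas (h @^-1` (A `\ 0)).
Proof. by move=> bA; exact: cmeasurable_borel (borel_setD0 bA). Qed.

Lemma cantor_content : projection_content [set: nat -> bool] cmeas E.
Proof.
split=> //.
- by rewrite -setC0; exact/cmeasurableC/cmeasurable0.
- by move=> A B; exact: cmeasurableI.
- by move=> A B; exact: cmeasurableD.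
- by move=> A; exact: cmeasure_proj.
- by move=> x; exact: cmeasure0.
- by move=> A B x; exact: cmeasureI.
- move=> A B x mA mB; rewrite -cmeasureU.
  + by rewrite setUIDK.
  + exact: cmeasurableI.
  + exact: cmeasurableD.
  + by apply/seteqP; split=> p // -[[_ Bp] [_ nBp]].
Qed.

Lemma plane_content : projection_content (@Cplus R) (@borel_Cplus R) Pi.
Proof.
have [CC CI CU CD] := @borel_algebra R.
split=> //.
- exact: borel_sub.
- by move=> A bA; exact/cmeasure_proj/plane_cmeas.
- by move=> x; rewrite /Pi set0D preimage_set0 cmeasure0.
- move=> A B x bA bB; rewrite /Pi -cmeasureI; try exact: plane_cmeas.
  congr (E _ x); apply/seteqP; split=> p /=.
    by move=> [[Ap Bp] p0].
  by move=> [[Ap p0] [Bp _]].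
- move=> A B x bA bB; rewrite /Pi -cmeasureU.
  + congr (E _ x); apply/seteqP; split=> p /=.
      by move=> [Ap p0]; have [Bp|nBp] := pselect (B (h p)); [left | right].
    by move=> [[[Ap _] p0]|[[Ap _] p0]].
  + by apply: plane_cmeas; exact: CI.
  + by apply: plane_cmeas; exact: CD.
  + by apply/seteqP; split=> p // -[[[_ Bp] _] [[_ nBp] _]].
Qed.

Lemma plane_measure_pvm : projection_valued_measure Pi.
Proof.
have pc := plane_content; split.
- by move=> A bA; exact: proj_orthogonal (pc_proj pc bA).
- exact: pc_empty pc.
- by move=> A B bA bB x; exact: (pc_mul pc x bA bB).
- move=> A bA tA x; apply/limsP; rewrite /Pi.
  have -> : h @^-1` (\bigcup_n A n `\ 0) = \bigcup_n (h @^-1` (A n `\ 0)).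
    by rewrite -preimage_bigcup setD_bigcupl.
  have := @cmeasure_bigcup _ _ _ r_proj r_comm (fun n => h @^-1` (A n `\ 0)) x.
  have mA n : cmeas (h @^-1` (A n `\ 0)) by exact: plane_cmeas.
  move=> /(_ mA) => lim; apply: eq_lims (lim _).
    by move=> n; rewrite seriesEord.
  by move=> i j _ _ [p [[Ai _] [Aj _]]]; apply: tA => //; exists (h p).
Qed.

Lemma plane_measure_compact : compactly_supported Pi.
Proof.
exists (box L); split; [exact: compact_box | exact: box_Cplus |].
move=> x; rewrite /Pi (_ : _ @^-1` _ = set0) ?cmeasure0//.
by apply/seteqP; split=> p // -[[_ nb] _]; apply: nb; exact: plane_point_box.
Qed.

Lemma plane_measure_kernel A y : (forall n, r n y = 0) -> borel_Cplus A -> Pi A y = 0.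
Proof.
move=> ry bA; apply: cmeasure_kernel => //; last exact: plane_cmeas.
by rewrite /= plane_point0 => -[].
Qed.

Local Notation capprox := (@approx_int R H (nat -> bool) setT cmeas E).
Local Notation papprox := (@approx_int R H (Cx R) (@Cplus R) (@borel_Cplus R) Pi).

(** Removing the point 0 makes the pulled back simple functions vanish over it, which agrees with g
    exactly when g 0 = 0. *)
Lemma plane_approx_pullback (g : Cx R -> Cx R) (T : H -> H) : g 0 = 0 ->
  papprox g T -> capprox (fun p => g (h p)) T.
Proof.
move=> g0 gT e e0; have [s [ms gs Ts]] := gT e e0.
exists [seq (cA.1, h @^-1` (cA.2 `\ 0)) | cA <- s]; split.
- by move=> c A /mapP[[c' A'] /= /ms mA [_ ->]]; exact: plane_cmeas.
- move=> p _; rewrite /sfun big_map /=.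
  have [h0|h0] := eqVneq (h p) 0.
    rewrite h0 g0 big1 ?subrr ?csq0 ?(ltW e0)// => cA _.
    by rewrite indicE memNset ?mulr0// => -[_]; apply.
  rewrite (eq_bigr (fun cA => cA.1 * \1_(cA.2) (h p))).
    by apply: gs; exact: plane_point_Cplus.
  move=> cA _; congr (_ * _); rewrite !indicE; congr (_%:R); congr nat_of_bool.
  apply/idP/idP; rewrite !inE /=; first by case.
  by move=> Ap; split=> //; exact/eqP.
- by move=> x; rewrite /sint big_map; exact: Ts.
Qed.

(** The partial sums of the expansion are simple functions on clopen sets, and the same n bounds the
    error of the function and of the operator. [sigma] selects the even or the odd bits. *)
Lemma digit_approx (sigma : nat -> nat) (A : H -> H) :
  (forall n x, nsq (A x - \sum_(k < n) rscale (2^-1 ^+ k.+1) (r (sigma k) x))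
                 <= (2^-1 ^+ n) ^+ 2 * nsq x) ->
  capprox (fun p => (L * bin_exp (fun k => p (sigma k)))%:C%C) (fun x => rscale L (A x)).
Proof.
move=> hA e e0; have se0 : 0 < Num.sqrt e by rewrite sqrtr_gt0.
have [|n] := @half_exp_small R (Num.sqrt e / L); first by rewrite divr_gt0.
rewrite ler_pdivlMr// mulrC => hn.
have {}hn : (L * 2^-1 ^+ n) ^+ 2 <= e.
  rewrite -[leRHS]sqr_sqrtr ?(ltW e0)// ler_sqr ?nnegrE ?(ltW se0)//.
  by rewrite mulr_ge0 ?(ltW L0) ?(ltW (half_exp_gt0 n)).
exists [seq ((L * 2^-1 ^+ k.+1)%:C%C, [set p | cmem (CBit (sigma k)) p]) | k <- index_iota 0 n].
split.
- by move=> c S /mapP[k _ [_ ->]]; exact: (cmeasurable_clopen r_proj r_comm (CBit _)).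
- move=> p _; set f := fun k => p (sigma k).
  have -> : sfun [seq ((L * 2^-1 ^+ k.+1)%:C%C, [set p | cmem (CBit (sigma k)) p])
      | k <- index_iota 0 n] p = (L * bin_sum f n)%:C%C :> Cx R.
    rewrite /sfun big_map big_mkord /bin_sum mulr_sumr rmorph_sum.
    apply: eq_bigr => k _; rewrite indicE mulrA [RHS]rmorphM; congr (_ * _).
    rewrite rmorph_nat; congr (_%:R); congr nat_of_bool.
    by apply/idP/idP; rewrite inE.
  rewrite -rmorphB csq_real -mulrBr; apply: le_trans hn.
  rewrite !exprMn ler_wpM2l ?sqr_ge0// ler_sqr ?nnegrE ?(ltW (half_exp_gt0 n))//.
    by rewrite lerBlDl; case/andP: (bin_exp_bounds (R := R) f n).
  by rewrite subr_ge0; case/andP: (bin_exp_bounds (R := R) f n).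
- move=> x.
  have -> : sint E [seq ((L * 2^-1 ^+ k.+1)%:C%C, [set p | cmem (CBit (sigma k)) p])
      | k <- index_iota 0 n] x =
      rscale L (\sum_(k < n) rscale (2^-1 ^+ k.+1) (r (sigma k) x)).
    rewrite /sint big_map big_mkord /rscale scaler_sumr.
    apply: eq_bigr => k _; rewrite cmeasure_clopen /= scalerA rmorphM.
    by [].
  have -> : rscale L (A x) - rscale L (\sum_(k < n) rscale (2^-1 ^+ k.+1) (r (sigma k) x)) =
      rscale L (A x - \sum_(k < n) rscale (2^-1 ^+ k.+1) (r (sigma k) x)).
    by apply: ip_ext => t; rewrite !ipE; lra.
  rewrite nsqZ; apply: (@le_trans _ _ (L ^+ 2 * ((2^-1 ^+ n) ^+ 2 * nsq x))).
    by rewrite ler_wpM2l ?sqr_ge0.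
  by rewrite mulrA -exprMn ler_wpM2r ?nsq_ge0.
Qed.

End PlaneMeasure.

(** * The filter *)

Section CommutingPair.
Context {R : realType} {H : hilbertSpace R}.
Implicit Types (x y : H) (A T P : H -> H).

Lemma scaled_effect T (L : R) : 0 < L -> linear T -> sym_op T -> pos_op T ->
  (forall x, nsq (T x) <= L ^+ 2 * nsq x) -> effect (fun x => rscale L^-1 (T x)).
Proof.
move=> L0 lT sT pT TL; split.
- exact: linear_Z.
- by move=> x y; rewrite !ipE sT.
- by move=> x; rewrite ipE mulr_ge0 ?invr_ge0 ?(ltW L0).
- move=> x; rewrite ipE mulrC ler_pdivrMr// mulrC.
  have x0 := nsq_ge0 x.
  have Lx0 : 0 <= L * nsq x by rewrite mulr_ge0 ?(ltW L0).
  rewrite -ler_sqr ?nnegrE//; apply: le_trans (ip_CauchySchwarz _ _) _.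
  have -> : (L * nsq x) ^+ 2 = L ^+ 2 * nsq x * nsq x by ring.
  exact: ler_wpM2r.
Qed.

(** <Ay, y> is the sum of the nonnegative numbers 2^-(k+1) |P_k y|^2, so all of them vanish when A y
    = 0. *)
Lemma digit_kernel A (P : nat -> H -> H) y : (forall n, proj_op (P n)) ->
  (forall n x, nsq (A x - \sum_(k < n) rscale (2^-1 ^+ k.+1) (P k x))
                 <= (2^-1 ^+ n) ^+ 2 * nsq x) ->
  A y = 0 -> forall n, P n y = 0.
Proof.
move=> pP AP Ay n; apply/nsq_eq0/eqP; rewrite eq_le nsq_ge0 andbT.
have sumE m : ip (\sum_(k < m) rscale (2^-1 ^+ k.+1) (P k y)) y =
    \sum_(k < m) 2^-1 ^+ k.+1 * nsq (P k y).
  elim: m => [|m IH]; first by rewrite !big_ord0 ip0l.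
  by rewrite !big_ord_recr /= ipDl IH ipZl proj_nsq.
have y0 := nsq_ge0 y.
have bound m : \sum_(k < m) 2^-1 ^+ k.+1 * nsq (P k y) <= 2^-1 ^+ m * nsq y.
  have a0 := ltW (half_exp_gt0 (R := R) m).
  rewrite -sumE; apply: le_trans (ler_norm _) _.
  rewrite -[leRHS]ger0_norm ?mulr_ge0// -ler_sqr ?nnegrE// !real_normK ?num_real//.
  apply: le_trans (ip_CauchySchwarz _ _) _.
  have := AP m y; rewrite Ay sub0r nsqN => h.
  have -> : (2^-1 ^+ m * nsq y) ^+ 2 = (2^-1 ^+ m) ^+ 2 * nsq y * nsq y by ring.
  exact: ler_wpM2r.
(* Only the term of index n is kept out of n + 1 + m; the factor 2^-(n+1) then cancels and 2^-m is
   arbitrarily small. *)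
have term m : 2^-1 ^+ n.+1 * nsq (P n y) <= 2^-1 ^+ (n.+1 + m) * nsq y.
  apply: le_trans (bound _); rewrite big_split_ord /= big_ord_recr /=.
  rewrite -addrA addrCA lerDl addr_ge0// sumr_ge0// => k _;
    by rewrite mulr_ge0 ?nsq_ge0 ?(ltW (half_exp_gt0 _)).
apply/ler_addgt0Pr => e e0; rewrite add0r.
have y1 : 0 < nsq y + 1 by lra.
have [m hm] := half_exp_small (divr_gt0 e0 y1).
have := term m; rewrite exprD -mulrA ler_pM2l ?half_exp_gt0// => h.
apply: le_trans h _; rewrite ler_pdivlMr// in hm.
by apply: le_trans hm; rewrite ler_wpM2l ?(ltW (half_exp_gt0 _))//; lra.
Qed.

Lemma effect_ker A y : effect A -> ip (A y) y = 0 -> A y = 0.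
Proof.
move=> eA Ay; apply/nsq_eq0/eqP; rewrite eq_le nsq_ge0 andbT -Ay.
exact: effect_nsq.
Qed.

Lemma effect_mean A B : effect A -> effect B ->
  effect (fun x => rscale 2^-1 (A x + B x)).
Proof.
move=> [lA sA pA A1] [lB sB pB B1]; split.
- by apply: linear_Z; exact: linear_D.
- by move=> x y; rewrite !ipE sA sB.
- by move=> x; rewrite !ipE; have := pA x; have := pB x; lra.
- by move=> x; rewrite !ipE; have := A1 x; have := B1 x; lra.
Qed.

(* V vanishes on the range of A + B, hence equals V P for the projection P
   onto the common kernel of A and B. *)
Lemma sum_range_kernel A B V : effect A -> effect B -> cont_op V ->
  (forall x, V (A x + B x) = 0) ->
  (forall y, A y = 0 -> B y = 0 -> V y = 0) -> forall x, V x = 0.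
Proof.
move=> eA eB cV VAB Vker x; have [lV _] := cV.
have [P [_ NP _ _ VP]] := exists_kernel_proj (effect_sac (effect_mean eA eB)).
have <- : V (P x) = V x.
  by apply: VP => // z; rewrite (lin_Z lV) VAB /rscale scaler0.
have [_ _ pA _] := eA; have [_ _ pB _] := eB.
have := congr1 (fun v => ip v (P x)) (NP x); rewrite /= !ipE => h.
have := pA (P x); have := pB (P x) => h1 h2.
by apply: Vker; apply: effect_ker => //; lra.
Qed.

End CommutingPair.

Theorem theorem5p1 (R : realType) (d : nat) (disp : measure_display)
    (Omega : measurableType disp) (P : probability Omega R)
    (u w : schwartz R d -> Omega -> Cx R)
    (gsp_u : gsp P u) (gsp_w : gsp P w) (uncor : uncorrelated P u w)
    (Ku Kw : schwartz R d -> tempered R d)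
    (cov_u : covariance_operator P u Ku) (cov_w : covariance_operator P w Kw)
    (H : hilbert_of_distributions R d) (Tu Tw : H -> H)
    (Ku_LH : bounded_on Ku Tu) (Kw_LH : bounded_on Kw Tw)
    (Tu_ge0 : nonneg_operator Tu) (Tw_ge0 : nonneg_operator Tw)
    (commute : Tu \o Tw = Tw \o Tu) :
  exists Pi : set (Cx R) -> H -> H,
    projection_valued_measure Pi /\ compactly_supported Pi /\
    exists fu fw : Cx R -> Cx R,
      [/\ Cc_Cplus fu, Cc_Cplus fw,
          forall z, Cplus z -> 0 <= fu z & forall z, Cplus z -> 0 <= fw z] /\
      spectral_integral Pi fu Tu /\ spectral_integral Pi fw Tw /\
      exists F : H -> H,
        [/\ spectral_integral Pi (filter_symbol fu fw) F,
            Tu = F \o (Tu \+ Tw),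
            nonneg_operator F &
            forall G, bounded_functional_calculus Pi G ->
              Tu = G \o (Tu \+ Tw) -> G = F].
Proof.
have [bTu _ _] := Ku_LH; have [bTw _ _] := Kw_LH.
have cTu := bounded_cont bTu; have cTw := bounded_cont bTw.
have [lu [Cu [Cu0 hCu]]] := cTu; have [lw [Cw [Cw0 hCw]]] := cTw.
have su := nonneg_sym lu Tu_ge0; have sw := nonneg_sym lw Tw_ge0.
have pu := nonneg_pos Tu_ge0; have pw := nonneg_pos Tw_ge0.
(* [Cu] and [Cw] bound squared norms; as L >= 1, they are at most L and so at most L^2, which
   [scaled_effect] asks for. *)
pose L := Cu + Cw + 1.
have L1 : 1 <= L by rewrite /L; lra.
have L0 : 0 < L by lra.
have Lsq : L <= L ^+ 2 by rewrite expr2; nra.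
pose Au x := rscale L^-1 (Tu x); pose Aw x := rscale L^-1 (Tw x).
have eu : effect Au.
  apply: scaled_effect => // x; apply: le_trans (hCu x) _.
  by rewrite ler_wpM2r ?nsq_ge0//; apply: le_trans Lsq; rewrite /L; lra.
have ew : effect Aw.
  apply: scaled_effect => // x; apply: le_trans (hCw x) _.
  by rewrite ler_wpM2r ?nsq_ge0//; apply: le_trans Lsq; rewrite /L; lra.
have LAu x : rscale L (Au x) = Tu x.
  by rewrite /Au /rscale scalerA -rmorphM divff ?gt_eqF// scale1r.
have LAw x : rscale L (Aw x) = Tw x.
  by rewrite /Aw /rscale scalerA -rmorphM divff ?gt_eqF// scale1r.
have comm_uw : commutes Au Aw.
  move=> x; rewrite /Au /Aw (lin_Z lu) (lin_Z lw); congr (rscale _ (rscale _ _)).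
  exact: (congr1 (fun f => f x) commute).
have cAu := sac_cont (effect_sac eu); have cAw := sac_cont (effect_sac ew).
have [Du [pDu cDu sDu]] := binary_digits eu.
have [Dw [pDw cDw sDw]] := binary_digits ew.
have symm (S T : H -> H) : commutes S T -> commutes T S by move=> ST x.
have Du_Au n : commutes (Du n) Au by apply: symm; exact: cDu.
have Dw_Aw n : commutes (Dw n) Aw by apply: symm; exact: cDw.
(* A digit commutes with whatever commutes with its operator: the digits of [Au] thus commute with
   [Aw], and then with the digits of [Aw]. *)
have Du_Aw n : commutes (Du n) Aw by apply: symm; apply: cDu => //; exact: symm.
(* Interleaved to match [plane_point]: even indices for the real part, odd ones for the imaginary
   part. *)
pose r n := if odd n then Dw n./2 else Du n./2.
have r_proj n : proj_op (r n) by rewrite /r; case: ifP.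
have Du_Dw m n : commutes (Du m) (Dw n) by apply: cDw => //; exact: proj_cont.
have r_comm m n : commutes (r m) (r n).
  rewrite /r; case: ifP => _; case: ifP => _ //.
  - by apply: cDw; [exact: proj_cont|].
  - exact: symm.
  - by apply: cDu; [exact: proj_cont|].
have r_even n : r n.*2 = Du n by rewrite /r odd_double doubleK.
have r_odd n : r n.*2.+1 = Dw n by rewrite /r /= odd_double /= uphalf_double.
pose Pi := plane_measure r_proj r_comm L.
have pcC := cantor_content r_proj r_comm.
have pcP := plane_content r_proj r_comm L0.
exists Pi; split; first exact: plane_measure_pvm.
split; first exact: plane_measure_compact.
pose fu z : Cx R := (cutRe L z)%:C%C; pose fw z : Cx R := (cutIm L z)%:C%C.
have fu_bnd z : Cplus z -> csq (fu z) <= (3 * L) ^+ 2.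
  by move=> Cz; have [] := cut_bounded (ltW L0) Cz.
have fw_bnd z : Cplus z -> csq (fw z) <= (3 * L) ^+ 2.
  by move=> Cz; have [] := cut_bounded (ltW L0) Cz.
have L3 : 0 <= 3 * L by lra.
have bu : bounded_borel fu.
  apply: continuous_borel fu_bnd L3.
  exact/complexify_continuous/cutRe_continuous.
have bw : bounded_borel fw.
  apply: continuous_borel fw_bnd L3.
  exact/complexify_continuous/cutIm_continuous.
have L_ge0 : (0 : R) <= 0 <= L by rewrite lexx ltW.
have fu_point p : fu (plane_point L p) = (complex.Re (plane_point L p))%:C%C.
  by rewrite /fu /cutRe; have [h1 h2] := plane_point_box L0 p; rewrite cutoff_id.
have fw_point p : fw (plane_point L p) = (complex.Im (plane_point L p))%:C%C.
  by rewrite /fw /cutIm; have [h1 h2] := plane_point_box L0 p; rewrite cutoff_id.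
have exists_int g : bounded_borel g -> exists T (f : nat -> seq (Cx R * set (Cx R))),
    [/\ cont_op T, approx_int Cplus borel_Cplus Pi g T,
      forall n, smeas borel_Cplus (f n) /\ forall c A, (c, A) \in f n -> (g @` Cplus) c &
      forall x, lims (fun n => sint Pi (f n) x) (T x)].
  move=> bg; have [K gK] := bounded_borel_csq bg.
  by apply: (exists_approx_int pcP); apply: (simple_approximation pcP _ gK); case: bg.
(* The integral of g over the quadrant exists by Borel approximation; pulled back, it is an integral
   of the same function as T' on the Cantor space, where integrals are unique. *)
have ident g T T' : bounded_borel g -> g 0 = 0 ->
    approx_int [set: nat -> bool] (cmeasurable r) (cmeasure r_proj r_comm)
      (fun p => g (plane_point L p)) T' -> T' =1 T ->
    approx_int Cplus borel_Cplus Pi g T.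
  move=> bg g0 gT' T'T; have [T0 [_ [_ gT0 _ _]]] := exists_int g bg.
  suff -> : T = T0 by [].
  apply/funext => x; rewrite -T'T; symmetry.
  apply: (approx_int_unique pcC _ (plane_approx_pullback L0 g0 gT0) gT') => //.
have au : approx_int Cplus borel_Cplus Pi fu Tu.
  apply: (ident _ _ (fun x => rscale L (Au x))) => //.
    by rewrite /fu /cutRe cutoff_id.
  have := digit_approx r_proj r_comm L0 (sigma := double) (A := Au).
  move=> h e e0; have [|s [h1 h2 h3]] := h _ e e0.
    by move=> n x; under eq_bigr do rewrite r_even; exact: sDu.
  by exists s; split=> // p Wp; rewrite fu_point; exact: h2.
have aw : approx_int Cplus borel_Cplus Pi fw Tw.
  apply: (ident _ _ (fun x => rscale L (Aw x))) => //.
    by rewrite /fw /cutIm cutoff_id.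
  have := digit_approx r_proj r_comm L0 (sigma := fun k => k.*2.+1) (A := Aw).
  move=> h e e0; have [|s [h1 h2 h3]] := h _ e e0.
    by move=> n x; under eq_bigr do rewrite r_odd; exact: sDw.
  by exists s; split=> // p Wp; rewrite fw_point; exact: h2.
have fu0 z : 0 <= cutRe L z by exact: cutoff_ge0.
have fw0 z : 0 <= cutIm L z by exact: cutoff_ge0.
exists fu, fw; split.
  by have [? ?] := cut_Cc (ltW L0); split=> // z _; rewrite /fu /fw ler0c.
split; first exact: approx_spectral.
split; first exact: approx_spectral.
have bF : bounded_borel (filter_symbol fu fw).
  by apply: filter_symbol_borel => //; [exact: cutRe_continuous | exact: cutIm_continuous].
have FE z : Cplus z -> filter_symbol fu fw z = (cutRe L z / (cutRe L z + cutIm L z))%:C%C.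
  exact: filter_symbolE.
have F01 z := filter_symbol_bounds fu0 fw0 z.
have [F [f [cF aF mf limF]]] := exists_int _ bF.
have [lF _] := cF.
have coef n c A : (c, A) \in f n -> exists2 a : R, 0 <= a & c = a%:C%C.
  have [_ h] := mf n; move=> /h[z Cz <-]; rewrite FE//.
  by exists (cutRe L z / (cutRe L z + cutIm L z)) => //; case/andP: (F01 z).
have FT x : F (Tu x + Tw x) = Tu x.
  have asum := approx_int_add au aw.
  (* One constant bounding both factors, as [approx_int_mul] requires. *)
  have K1 z : Cplus z -> csq (filter_symbol fu fw z) <= 4 * (3 * L) ^+ 2 + 1.
    move=> Cz; rewrite FE// csq_real.
    have : (cutRe L z / (cutRe L z + cutIm L z)) ^+ 2 <= 1.
      by have /andP[a1 a2] := F01 z; rewrite expr_le1.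
    by have := sqr_ge0 (3 * L); lra.
  have K2 z : Cplus z -> csq (fu z + fw z) <= 4 * (3 * L) ^+ 2 + 1.
    move=> Cz; apply: le_trans (csqD2 _ _) _.
    by have := fu_bnd z Cz; have := fw_bnd z Cz; lra.
  apply: (approx_int_unique pcP _ (approx_int_mul pcP K1 K2 aF asum) au) => z Cz.
  rewrite FE// /fu /fw -rmorphD -rmorphM; congr (_%:C%C).
  (* Where the denominator vanishes, both nonnegative summands do, so the product still equals
     fu. *)
  have [s0|s0] := eqVneq (cutRe L z + cutIm L z) 0; last by rewrite divfK.
  by rewrite s0 mulr0; have := fu0 z; have := fw0 z; lra.
have sp n := sint_sym_pos pcP (proj1 (mf n)) (coef n).
exists F; split.
- exact: approx_spectral.
- by apply/funext => x /=; rewrite FT.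
- apply: sym_pos_nonneg => //; first exact: lim_sym limF (fun n => proj1 (sp n)).
  move=> x; apply/ler_addgt0Pr => e e0.
  have [N hN] := lims_ip x (limF x) e0.
  have := hN N (leqnn N); have := proj2 (sp N) x; rewrite ler_norml; lra.
- move=> G [g gG] GT; apply/funext => x; apply/eqP; rewrite -subr_eq0; apply/eqP.
  have [bg bG _] := gG; have aG := spectral_approx gG; have cG := bounded_cont bG.
  (* All digits vanish on the common kernel, hence so does every Pi A, and with it every simple
     integral. *)
  have kill g' T y : approx_int Cplus borel_Cplus Pi g' T -> Au y = 0 -> Aw y = 0 -> T y = 0.
    move=> aT uy wy; apply: (@nsq_small_eq0 _ _ _ (nsq y)); first exact: nsq_ge0.
    move=> e e0; have [s [ms _ Ts]] := aT e e0.
    have ry n : r n y = 0.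
      by rewrite /r; case: ifP => _; [exact: (digit_kernel pDw sDw) | exact: (digit_kernel pDu sDu)].
    have := Ts y; rewrite mulrC (_ : sint Pi s y = 0) ?subr0//.
    rewrite /sint big_seq big1// => -[c A] /ms mA /=.
    by rewrite /Pi plane_measure_kernel ?scaler0.
  (* Applied to V = G - F; both solve the equation, so V vanishes on the range of Au + Aw, which is
     Tu + Tw divided by L. *)
  apply: (sum_range_kernel eu ew (contB cG cF)) => [y|y uy wy].
    rewrite -scalerDr (lin_Zc (proj1 cG)) (lin_Zc lF) FT -scalerBr.
    have /= <- := congr1 (fun f => f y) GT.
    by rewrite subrr scaler0.
  by rewrite (kill g G)// (kill _ F _ aF)// subrr.
Qed.
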